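(* For every $\epsilon>0$ there is $\delta>0$ such that for every finite-dimensional C*-algebra $F$, every C*-algebra $A$, and every $\delta$-$^*$-homomorphism $\phi\colon F\to A$, there exists a $^*$-homomorphism $\psi\colon F\to A$ such that for all $x\in F_{\le 1}$, $$\|\psi(x)-\phi(x)\|<\epsilon.$$
   Context: For a C*-algebra $A$, $A_{\le 1}$ denotes the closed unit ball $\{x\in A:\|x\|\le 1\}$, and $\mathbb{C}_{\le 1}=\{\lambda\in\mathbb{C}:|\lambda|\le 1\}$. For $\delta>0$, a map $\phi\colon A\to B$ between C*-algebras (not assumed linear or continuous) is called a $\delta$-$^*$-homomorphism if for all $x,y\in A_{\le 1}$ and $\lambda\in\mathbb{C}_{\le 1}$: $\|\phi(x+y)-\phi(x)-\phi(y)\|\le\delta$, $\|\phi(\lambda x)-\lambda\phi(x)\|\le\delta$, $\|\phi(xy)-\phi(x)\phi(y)\|\le\delta$, $\|\phi(x^* )-\phi(x)^*\|\le\delta$, and $\|\phi(x)\|\le 1+\delta$. *)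

(* Defs.v *)
(* MathComp-Analysis; complex numbers are R[i] with R : realType. *)
From HB Require Import structures.
From mathcomp Require Import all_boot all_order all_algebra.
From mathcomp Require Import complex.
From mathcomp Require Import boolp classical_sets reals topology normedtype.

Set Implicit Arguments.
Unset Strict Implicit.
Unset Printing Implicit Defensive.

Import Order.TTheory GRing.Theory Num.Theory.

Local Open Scope ring_scope.
Local Open Scope complex_scope.

(* C*-algebras are not assumed unital, so their product is the multiplicative
   semigroup operation (usually written in group_scope), not that of a ring. *)
Notation "x ** y" := (x%R * y%R)%g
  (at level 40, left associativity) : ring_scope.

(* As in every normed module over R[i], the values of the norm are elements
   of R[i]; being >= 0 in R[i], they are real. *)
HB.mixin Record isCStarAlgebra (R : realType) (A : Type)
    of CompleteNormedModule R[i] A & Semigroup A := {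
  star : A -> A;
  cstar_mulDl : forall x y z : A, (x + y) ** z = x ** z + y ** z;
  cstar_mulDr : forall x y z : A, x ** (y + z) = x ** y + x ** z;
  cstar_scaleAl : forall (l : R[i]) (x y : A), (l *: x) ** y = l *: (x ** y);
  cstar_scaleAr : forall (l : R[i]) (x y : A), x ** (l *: y) = l *: (x ** y);
  starK : involutive star;
  starD : forall x y : A, star (x + y) = star x + star y;
  starZ : forall (l : R[i]) (x : A), star (l *: x) = Num.conj l *: star x;
  starM : forall x y : A, star (x ** y) = star y ** star x;
  cstar_normM : forall x y : A, `|x ** y| <= `|x| * `|y|;
  cstar_norm_star : forall x : A, `|star x ** x| = `|x| ^+ 2
}.

#[short(type="cstarAlgType")]
HB.structure Definition CStarAlgebra (R : realType) :=
  { A of CompleteNormedModule R[i] A & Semigroup A & isCStarAlgebra R A }.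

Definition finite_dimensional (R : realType) (F : cstarAlgType R) : Prop :=
  exists n : nat, inhabited (Vector.axiom n F).

(* Not required to be unital, even when both algebras are. *)
Definition star_homomorphism (R : realType) (A B : cstarAlgType R)
    (psi : A -> B) : Prop :=
  [/\ linear psi,
      forall x y : A, psi (x ** y) = psi x ** psi y &
      forall x : A, psi (star x) = star (psi x)].

Definition delta_star_homomorphism (R : realType) (A B : cstarAlgType R)
    (delta : R) (phi : A -> B) : Prop :=
  forall (x y : A) (l : R[i]), `|x| <= 1 -> `|y| <= 1 -> `|l| <= 1 ->
  [/\ `|phi (x + y) - phi x - phi y| <= delta%:C,
      `|phi (l *: x) - l *: phi x| <= delta%:C,
      `|phi (x ** y) - phi x ** phi y| <= delta%:C,
      `|phi (star x) - star (phi x)| <= delta%:C &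
      `|phi x| <= 1 + delta%:C].

(* Main.v *)
(* On the unitary group [U] of [F], a compact group, [phi] is an approximate
   representation.  Its defect is squared, up to a constant which does not depend
   on the dimension, by a Newton step: if [c g h = f (g h) - f g f h], then
   [f g + M_h (f h^-1 c h g)] has defect [O(|c|^2)], where [M] is an invariant mean.
   Instead of the Haar measure, [M] is an average over a finite subset of [U] that
   is nearly invariant on Lipschitz functions.  The iteration yields a unitary
   representation [r] of [U] close to [phi].

   As [phi] is nearly linear, [r] is rigid.  The symmetry [1 - 2p] of a projection
   [p] gives the projection [q p = (E - r (1 - 2p)) / 2], and since a representation
   close to the trivial one is trivial, [r (sum_i l_i p_i) = sum_i l_i q p_i] for
   unimodular [l_i] and orthogonal [p_i] with sum [1].  So [r] is 1-Lipschitz at the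
   identity, and comparing [r] on unitaries of the form [1 + i t h + O(t^2)] as [t]
   tends to [0] shows that [sum_i a_i p_i |-> sum_i a_i q p_i] is additive on
   self-adjoint elements.  Its complex-linear extension agrees with [r] on [U], so
   it is a *-homomorphism, and it is close to [phi] on the unit ball because a
   self-adjoint contraction is the mean of a unitary and its adjoint. *)
Require Import Defs.
From HB Require Import structures.
From mathcomp Require Import all_boot all_order all_algebra.
From mathcomp Require Import complex reals topology normedtype derive.
From mathcomp Require Import boolp classical_sets.
From mathcomp Require Import lra ring.

Set Implicit Arguments.
Unset Strict Implicit.
Unset Printing Implicit Defensive.

Import Order.TTheory GRing.Theory Num.Theory.
Local Open Scope ring_scope.
Local Open Scope complex_scope.

(** * Norms and identities in C*-algebras *)

(** The constants must not depend on [F], so a compactness argument over a fixed [F] would not do.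
    The dimension affects Lipschitz constants and sizes of nets, hence the choice of the finite set
    averaged over, but no error bound. Three defects of the data are repaired on the way. [F] is not
    assumed unital, so its unit [e] has to be found. [A] may have no unit, and [phi e] is merely
    near a projection [E]; everything takes place in the corner of [E]. And [phi] need not be
    continuous, whereas the finite means are nearly invariant on Lipschitz functions only, so [phi]
    is smoothed on [U]. The distance from [r] to [phi] is a fixed number, so near-linearity of [phi]
    says nothing about [r] at small scales. Exact identities come from gaps: an idempotent of norm
    below 1 vanishes, and a representation near the trivial one is trivial. Smoothing and
    compression give a defect of at most [1600 delta] at distance [300 delta] from [phi]; the
    iteration moves the map by at most [4 * 1600 delta]. The total [6700 delta] is kept below 1/100,
    which makes the gaps available. *)

Section RealNorm.
Context {R : realType} {V : normedModType R[i]}.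
Implicit Types (x y z : V) (c : R[i]) (r : R).

Definition nrm x : R := complex.Re `|x|.

Lemma normE x : `|x| = (nrm x)%:C.
Proof. by rewrite /nrm RRe_real // ger0_real. Qed.

Lemma nrm_le x r : (`|x| <= r%:C) = (nrm x <= r).
Proof. by rewrite normE lecR. Qed.

Lemma nrm_lt x r : (`|x| < r%:C) = (nrm x < r).
Proof. by rewrite normE ltcR. Qed.

Lemma nrm_le1 x : (`|x| <= 1) = (nrm x <= 1).
Proof. exact: nrm_le. Qed.

Lemma nrm_ge0 x : 0 <= nrm x.
Proof. by rewrite -lecR -normE normr_ge0. Qed.

Lemma nrm0 : nrm 0 = 0.
Proof. by rewrite /nrm normr0. Qed.

Lemma nrmN x : nrm (- x) = nrm x.
Proof. by rewrite /nrm normrN. Qed.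

Lemma nrmC x y : nrm (x - y) = nrm (y - x).
Proof. by rewrite -nrmN opprB. Qed.

Lemma nrmD x y : nrm (x + y) <= nrm x + nrm y.
Proof. by rewrite -lecR rmorphD /= -!normE ler_normD. Qed.

Lemma nrmB x y : nrm (x - y) <= nrm x + nrm y.
Proof. by rewrite -(nrmN y) nrmD. Qed.

Lemma nrm_sub z x y : nrm (x - y) <= nrm (x - z) + nrm (z - y).
Proof. by rewrite -[x - y](subrKA z) nrmD. Qed.

Lemma nrm_subl x y : nrm x <= nrm y + nrm (x - y).
Proof. by rewrite -{1}[x](subrKC y) nrmD. Qed.

Lemma nrm0_eq0 x : nrm x = 0 -> x = 0.
Proof. by move=> h; apply/eqP; rewrite -normr_eq0 normE h. Qed.

Lemma nrm_le0 x : nrm x <= 0 -> x = 0.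
Proof. by move=> h; apply/nrm0_eq0/le_anti; rewrite h nrm_ge0. Qed.

Lemma nrm_small x : (forall e, 0 < e -> nrm x <= e) -> x = 0.
Proof.
move=> h; apply: nrm_le0; rewrite leNgt; apply/negP => x0.
by have := h (nrm x / 2) (divr_gt0 x0 (ltr0n _ 2)); lra.
Qed.

Lemma nrmZ c x : nrm (c *: x) = complex.Re `|c| * nrm x.
Proof.
apply: complexI; rewrite rmorphM /= -!normE.
by rewrite normrZ.
Qed.

Lemma normcR r : `|r%:C| = `|r|%:C :> R[i].
Proof. by rewrite normc_def /= expr0n addr0 sqrtr_sqr. Qed.

Lemma nrmZr r x : nrm (r%:C *: x) = `|r| * nrm x.
Proof. by rewrite nrmZ normcR. Qed.

Lemma nrm_sum (I : Type) (s : seq I) (P : pred I) (f : I -> V) :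
  nrm (\sum_(i <- s | P i) f i) <= \sum_(i <- s | P i) nrm (f i).
Proof.
elim/big_rec2: _ => [|i x y _ h]; first by rewrite nrm0.
by apply: le_trans (nrmD _ _) _; rewrite lerD2l.
Qed.

Lemma scalerC2 r s x : r%:C *: (s%:C *: x) = (r * s)%:C *: x.
Proof. by rewrite scalerA rmorphM. Qed.

End RealNorm.

Section CStarBasics.
Context {R : realType} {A : cstarAlgType R}.
Implicit Types (x y z : A) (c : R[i]).

(* Instances stated at the type of [A]: applying the general lemmas instead can
   produce operations elaborated through another inheritance path, which [lra]
   does not identify. *)
Lemma cnrmC x y : nrm (x - y) = nrm (y - x). Proof. exact: nrmC. Qed.

Lemma cnrmD x y : nrm (x + y) <= nrm x + nrm y. Proof. exact: nrmD. Qed.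

Lemma cnrmB x y : nrm (x - y) <= nrm x + nrm y. Proof. exact: nrmB. Qed.

Lemma cnrm_sub z x y : nrm (x - y) <= nrm (x - z) + nrm (z - y).
Proof. exact: nrm_sub. Qed.

Lemma cnrm_subl x y : nrm x <= nrm y + nrm (x - y).
Proof. exact: nrm_subl. Qed.

Lemma cmulA x y z : x ** (y ** z) = x ** y ** z.
Proof. exact: mulgA. Qed.

Lemma cmul0r x : 0 ** x = 0.
Proof. by apply: (addrI (0 ** x)); rewrite -cstar_mulDl !addr0. Qed.

Lemma cmulr0 x : x ** 0 = 0.
Proof. by apply: (addrI (x ** 0)); rewrite -cstar_mulDr !addr0. Qed.

Lemma cmulNr x y : (- x) ** y = - (x ** y).
Proof. by apply: (addrI (x ** y)); rewrite -cstar_mulDl !subrr cmul0r. Qed.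

Lemma cmulrN x y : x ** (- y) = - (x ** y).
Proof. by apply: (addrI (x ** y)); rewrite -cstar_mulDr !subrr cmulr0. Qed.

Lemma cmulBl x y z : (x - y) ** z = x ** z - y ** z.
Proof. by rewrite cstar_mulDl cmulNr. Qed.

Lemma cmulBr x y z : z ** (x - y) = z ** x - z ** y.
Proof. by rewrite cstar_mulDr cmulrN. Qed.

Lemma cmul_suml (I : Type) (s : seq I) (P : pred I) (f : I -> A) x :
  (\sum_(i <- s | P i) f i) ** x = \sum_(i <- s | P i) f i ** x.
Proof.
by elim/big_rec2: _ => [|i y z _ <-]; rewrite ?cmul0r ?cstar_mulDl.
Qed.

Lemma cmul_sumr (I : Type) (s : seq I) (P : pred I) (f : I -> A) x :
  x ** (\sum_(i <- s | P i) f i) = \sum_(i <- s | P i) x ** f i.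
Proof.
by elim/big_rec2: _ => [|i y z _ <-]; rewrite ?cmulr0 ?cstar_mulDr.
Qed.

Lemma star0 : star 0 = 0 :> A.
Proof. by apply: (addrI (star 0)); rewrite -starD !addr0. Qed.

Lemma starN x : star (- x) = - star x.
Proof. by apply: (addrI (star x)); rewrite -starD !subrr star0. Qed.

Lemma starB x y : star (x - y) = star x - star y.
Proof. by rewrite starD starN. Qed.

Lemma star_sum (I : Type) (s : seq I) (P : pred I) (f : I -> A) :
  star (\sum_(i <- s | P i) f i) = \sum_(i <- s | P i) star (f i).
Proof. by elim/big_rec2: _ => [|i y z _ <-]; rewrite ?star0 ?starD. Qed.

Lemma conjCR (r : R) : Num.conj r%:C = r%:C :> R[i].
Proof. by apply/CrealP; rewrite complex_real. Qed.

Lemma conjCc (c : R[i]) : Num.conj c = conjc c.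
Proof.
have [->|c0] := eqVneq c 0; first by rewrite !rmorph0.
by apply: (mulfI c0); rewrite -normCK sqr_normc.
Qed.

Lemma starZr (r : R) x : star (r%:C *: x) = r%:C *: star x.
Proof. by rewrite starZ conjCR. Qed.

Lemma nrmM x y : nrm (x ** y) <= nrm x * nrm y.
Proof. by rewrite -lecR rmorphM /= -!normE cstar_normM. Qed.

Lemma nrm_starM x : nrm (star x ** x) = nrm x ^+ 2.
Proof. by apply: complexI; rewrite rmorphXn /= -!normE cstar_norm_star. Qed.

Lemma nrm_star x : nrm (star x) = nrm x.
Proof.
suff le y : nrm y <= nrm (star y).
  by apply/le_anti; rewrite le -{2}(starK x) le.
have [->|y0] := eqVneq (nrm y) 0; first exact: nrm_ge0.
have yp : 0 < nrm y by rewrite lt_def y0 nrm_ge0.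
by have := nrmM (star y) y; rewrite nrm_starM expr2 ler_pM2r.
Qed.

Lemma nrmM_star x : nrm (x ** star x) = nrm x ^+ 2.
Proof. by rewrite -{1}(starK x) nrm_starM nrm_star. Qed.

Lemma starM_eq0 x : star x ** x = 0 -> x = 0.
Proof.
move=> h; apply: nrm0_eq0; have := nrm_starM x; rewrite h nrm0.
by move/esym/eqP; rewrite sqrf_eq0 => /eqP.
Qed.

Lemma Mstar_eq0 x : x ** star x = 0 -> x = 0.
Proof.
move=> h; apply: nrm0_eq0; have := nrmM_star x; rewrite h nrm0.
by move/esym/eqP; rewrite sqrf_eq0 => /eqP.
Qed.

Lemma nrmM_le x y a b : nrm x <= a -> nrm y <= b -> nrm (x ** y) <= a * b.
Proof.
by move=> xa yb; apply: le_trans (nrmM _ _) _; apply: ler_pM => //; exact: nrm_ge0.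
Qed.

Lemma nrmM_sub x y x' y' :
  nrm (x ** y - x' ** y') <= nrm (x - x') * nrm y + nrm x' * nrm (y - y').
Proof.
have -> : x ** y - x' ** y' = (x - x') ** y + x' ** (y - y').
  by rewrite cmulBl cmulBr addrA subrK.
by apply: le_trans (nrmD _ _) _; apply: lerD; exact: nrmM.
Qed.

End CStarBasics.

(* A decision procedure for identities in non-unital noncommutative rings:
   both sides are expanded into signed words and opposite words are cancelled. *)
Inductive ncexp := NCvar of nat | NC0 | NCadd of ncexp & ncexp
  | NCopp of ncexp | NCmul of ncexp & ncexp.

(** A sign, [true] for minus, and a nonempty word. The first letter is kept apart because without a
    unit the empty word has no value. *)
Definition ncword : Type := bool * (nat * seq nat).

Definition ncneg (w : ncword) : ncword := (~~ w.1, w.2).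

Definition ncwmul (v w : ncword) : ncword :=
  (v.1 (+) w.1, (v.2.1, v.2.2 ++ w.2.1 :: w.2.2)).

Fixpoint ncnorm (t : ncexp) : seq ncword :=
  match t with
  | NCvar n => [:: (false, (n, [::]))]
  | NC0 => [::]
  | NCadd t u => ncnorm t ++ ncnorm u
  | NCopp t => map ncneg (ncnorm t)
  | NCmul t u => [seq ncwmul v w | v <- ncnorm t, w <- ncnorm u]
  end.

(** Every round removes two words, so the length of the list is enough fuel. *)
Fixpoint nccancel (fuel : nat) (s : seq ncword) : bool :=
  match fuel, s with
  | _, [::] => true
  | n.+1, w :: s => (ncneg w \in s) && nccancel n (rem (ncneg w) s)
  | _, _ => false
  end.

Section NCEval.
Context {R : realType} {A : cstarAlgType R}.
Variable env : seq A.

Fixpoint nceval (t : ncexp) : A :=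
  match t with
  | NCvar n => nth 0 env n
  | NC0 => 0
  | NCadd t u => nceval t + nceval u
  | NCopp t => - nceval t
  | NCmul t u => nceval t ** nceval u
  end.

Definition ncweval (w : ncword) : A :=
  let m := foldl (fun a i => a ** nth 0 env i) (nth 0 env w.2.1) w.2.2 in
  if w.1 then - m else m.

Lemma ncweval_neg w : ncweval (ncneg w) = - ncweval w.
Proof. by case: w => [[] m]; rewrite /ncweval /= ?opprK. Qed.

Lemma ncweval_mul v w : ncweval (ncwmul v w) = ncweval v ** ncweval w.
Proof.
have aux (b a : A) s : foldl (fun a i => a ** nth 0 env i) (b ** a) s =
    b ** foldl (fun a i => a ** nth 0 env i) a s.
  by elim: s a => //= i s IH a; rewrite -cmulA IH.
case: v => b [m s]; case: w => c [n t]; rewrite /ncweval /=.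
by rewrite foldl_cat /= aux; case: b; case: c; rewrite /= ?cmulNr ?cmulrN ?opprK.
Qed.

Lemma ncnormP t : nceval t = \sum_(w <- ncnorm t) ncweval w.
Proof.
elim: t => [n||t IHt u IHu|t IHt|t IHt u IHu] /=.
- by rewrite big_seq1.
- by rewrite big_nil.
- by rewrite big_cat IHt IHu.
- by rewrite big_map IHt -sumrN; apply: eq_bigr => w _; rewrite ncweval_neg.
- rewrite big_allpairs_dep IHt cmul_suml; apply: eq_bigr => v _.
  by rewrite IHu cmul_sumr; apply: eq_bigr => w _; rewrite ncweval_mul.
Qed.

Lemma nccancelP n s : nccancel n s -> \sum_(w <- s) ncweval w = 0.
Proof.
elim: n s => [|n IH] [|w s] //=; rewrite ?big_nil //.
case/andP=> ws /IH h.
by rewrite big_cons (perm_big _ (perm_to_rem ws)) big_cons h /= addr0 ncweval_neg subrr.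
Qed.

Lemma nc_eq t u :
  (let s := ncnorm (NCadd t (NCopp u)) in nccancel (size s) s) ->
  nceval t = nceval u.
Proof. by move=> /nccancelP; rewrite -ncnormP => /eqP; rewrite subr_eq0 => /eqP. Qed.

End NCEval.

(* Atoms are compared up to conversion, since the same term can be elaborated
   through different inheritance paths. *)
Ltac nc_same a b :=
  match constr:(Set) with
  | _ => let _ := match constr:(Set) with _ => unify a b end in constr:(true)
  | _ => constr:(false)
  end.

Ltac nc_mem a l :=
  lazymatch l with
  | nil => constr:(false)
  | a :: _ => constr:(true)
  | ?b :: ?l' =>
    let s := nc_same a b in
    lazymatch s with true => constr:(true) | false => nc_mem a l' end
  end.

Ltac nc_add a l :=
  let b := nc_mem a l in
  lazymatch b with true => l | false => constr:(a :: l) end.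

Ltac nc_atoms t l :=
  lazymatch t with
  | (?x + ?y)%R => let l1 := nc_atoms x l in nc_atoms y l1
  | (- ?x)%R => nc_atoms x l
  | (?x ** ?y)%R => let l1 := nc_atoms x l in nc_atoms y l1
  | 0%R => l
  | _ => nc_add t l
  end.

Ltac nc_idx a l :=
  lazymatch l with
  | a :: _ => constr:(0%N)
  | ?b :: ?l' =>
    let s := nc_same a b in
    lazymatch s with
    | true => constr:(0%N)
    | false => let n := nc_idx a l' in constr:(S n)
    end
  end.

Ltac nc_reify t l :=
  lazymatch t with
  | (?x + ?y)%R =>
    let a := nc_reify x l in let b := nc_reify y l in constr:(NCadd a b)
  | (- ?x)%R => let a := nc_reify x l in constr:(NCopp a)
  | (?x ** ?y)%R =>
    let a := nc_reify x l in let b := nc_reify y l in constr:(NCmul a b)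
  | 0%R => constr:(NC0)
  | _ => let n := nc_idx t l in constr:(NCvar n)
  end.

Ltac nc_ring :=
  rewrite ?mulrS ?mulr1n ?mulr0n;
  lazymatch goal with
  | |- @eq ?T ?x ?y =>
    let l := nc_atoms x (@nil T) in
    let l := nc_atoms y l in
    let t := nc_reify x l in
    let u := nc_reify y l in
    apply: (@nc_eq _ _ l t u); vm_compute; reflexivity
  end.

(** * Newton iteration *)

Section Limits.
Context {R : realType}.

Lemma gt0_complex (e : R[i]) : 0 < e -> exists2 r : R, 0 < r & e = r%:C.
Proof.
move=> e0; exists (complex.Re e).
  by move: e0; rewrite ltcE => /andP[_].
by rewrite RRe_real // gtr0_real.
Qed.

Lemma expr_small (x C e : R) : 0 <= x < 1 -> 0 < e -> exists k, C * x ^+ k <= e.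
Proof.
move=> /andP[x0 x1] e0.
(* Bernoulli's inequality without division; it bounds [x ^+ n] by a multiple of [1 / n]. *)
have bernoulli n : x ^+ n * (1 + n%:R * (1 - x)) <= 1.
  elim: n => [|n IH]; first by rewrite expr0 mul0r addr0 mulr1.
  rewrite exprSr -natr1; have := exprn_ge0 n x0.
  set y := x ^+ n in IH *; set k := n%:R in IH *.
  have k0 : 0 <= k by rewrite ler0n.
  have h : 0 <= (k + 1) * (1 - x) ^+ 2 by rewrite mulr_ge0 ?sqr_ge0 ?addr_ge0.
  move=> y0; have := mulr_ge0 y0 h; lra.
have [C0|C0] := leP C 0.
  by exists 0%N; rewrite expr0 mulr1; apply: le_trans C0 (ltW e0).
have ex0 : 0 < e * (1 - x) by rewrite mulr_gt0 // subr_gt0.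
exists (Num.bound (C / (e * (1 - x)))); set n := Num.bound _.
have hn : C < n%:R * (e * (1 - x)).
  rewrite -ltr_pdivrMr //; apply: archi_boundP.
  by rewrite divr_ge0 // ltW.
have := bernoulli n; have := exprn_ge0 n x0; set y := x ^+ n => y0 hb.
have : C * y <= e * (1 + n%:R * (1 - x)) * y.
  by rewrite ler_wpM2r //; lra.
have : 0 <= 1 - y * (1 + n%:R * (1 - x)) by rewrite subr_ge0.
by move=> /(mulr_ge0 (ltW e0)); lra.
Qed.

Lemma expr4V_small (C e : R) : 0 < e -> exists k, C * 4^-1 ^+ k <= e.
Proof. by apply: expr_small; rewrite invr_ge0 ler0n invf_lt1 // ltr1n. Qed.

Lemma geometric_limit {V : completeNormedModType R[i]} (u : nat -> V) (C : R) :
  (forall k, nrm (u k.+1 - u k) <= C * 4^-1 ^+ k) ->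
  exists l, forall k, nrm (u k - l) <= 2 * C * 4^-1 ^+ k.
Proof.
move=> hu.
have C0 : 0 <= C by have := hu 0%N; rewrite expr0 mulr1; apply: le_trans; exact: nrm_ge0.
have p0 k : 0 <= 4^-1 ^+ k :> R by rewrite exprn_ge0 // invr_ge0.
(* [3/2] exceeds the sum [4/3] of the geometric series; the gap up to [2] yields the strict
   inequality that open balls require. *)
have tail k m : nrm (u (k + m)%N - u k) <= 3/2 * C * 4^-1 ^+ k.
  suff : nrm (u (k + m)%N - u k) <= 3/2 * C * (4^-1 ^+ k - 4^-1 ^+ (k + m)).
    move=> h; apply: le_trans h _; rewrite ler_wpM2l //; first by apply: mulr_ge0 => //; lra.
    by rewrite gerBl.
  elim: m => [|m IH]; first by rewrite addn0 !subrr nrm0 mulr0.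
  apply: le_trans (nrm_sub (u (k + m)%N) _ _) _.
  have := hu (k + m)%N; rewrite addnS exprS => h1.
  have := p0 (k + m)%N; set x := 4^-1 ^+ (k + m) in IH h1 *; set y := 4^-1 ^+ k in IH *.
  by move=> x0; apply: le_trans (lerD h1 IH) _; nra.
have cu : cvg (u @ \oo)%classic.
  apply: cauchy_cvg; apply: cauchy_exP => _ /gt0_complex[e e0 ->].
  have [k hk] := expr4V_small (2 * C) e0.
  exists (u k); exists k => //= n kn.
  rewrite -ball_normE /= nrm_lt nrmC -(subnKC kn).
  apply: le_lt_trans (tail _ _) _.
  have [C00|Cn0] := eqVneq C 0; first by rewrite C00 mulr0 mul0r.
  apply: lt_le_trans hk; rewrite ltr_pM2r ?exprn_gt0 ?invr_gt0 //.
  have : 0 < C by rewrite lt_def Cn0.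
  by move=> ?; nra.
exists (lim (u @ \oo)%classic) => k.
apply/ler_addgt0Pr => e e0.
move/cvgrPdist_lt: cu => /(_ e%:C); rewrite ltcR => /(_ e0)[N _ hN].
have := hN (k + N)%N (leq_addl _ _); rewrite /= nrm_lt => h.
apply: le_trans (nrm_sub (u (k + N)%N) _ _) _.
rewrite (nrmC (u k)) (nrmC _ (lim _)); apply: lerD; last exact: ltW.
apply: le_trans (tail _ _) _; rewrite ler_wpM2r // ler_wpM2r //; lra.
Qed.

(** The predicate [good] need not be closed under limits: for approximate representations the
    Lipschitz constant may blow up along the iteration. So the limit [g] comes with [good] maps of
    arbitrarily small defect at arbitrarily small distance, from which exact identities for [g] are
    deduced. *)
Lemma newton_limit {V : completeNormedModType R[i]} (I : Type)
    (good : R -> (I -> V) -> Prop) (C eps0 : R) :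
  0 <= C ->
  (forall eps f, 0 < eps -> eps <= eps0 -> good eps f ->
     exists2 f', good (eps / 4) f' & forall i, nrm (f' i - f i) <= C * eps) ->
  forall eps f, 0 < eps -> eps <= eps0 -> good eps f ->
  exists2 g : I -> V, forall i, nrm (g i - f i) <= 2 * C * eps &
    forall eta, 0 < eta -> exists eps' f',
      [/\ 0 < eps' <= eta, good eps' f' & forall i, nrm (f' i - g i) <= eta].
Proof.
move=> C0 step eps f e0 ee0 gf.
have p0 k : 0 < eps * 4^-1 ^+ k by rewrite mulr_gt0 // exprn_gt0 // invr_gt0.
have ple k : eps * 4^-1 ^+ k <= eps.
  by rewrite ger_pMr // exprn_ile1 ?invr_ge0 // invf_le1 // ler1n.
pose T k := {h | good (eps * 4^-1 ^+ k) h}.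
have stepT k (h : T k) : {h' : T k.+1 | forall i,
    nrm (sval h' i - sval h i) <= C * (eps * 4^-1 ^+ k)}.
  apply: cid; case: h => h gh /=.
  have [h' gh' hh'] := step _ _ (p0 k) (le_trans (ple k) ee0) gh.
  have gh2 : good (eps * 4^-1 ^+ k.+1) h' by rewrite exprSr mulrA.
  by exists (exist _ h' gh2).
have g0 : good (eps * 4^-1 ^+ 0) f by rewrite expr0 mulr1.
pose F := fix F k : T k := match k with 0%N => exist _ f g0 | k.+1 => sval (stepT k (F k)) end.
have hF k i : nrm (sval (F k.+1) i - sval (F k) i) <= C * eps * 4^-1 ^+ k.
  by rewrite -mulrA; exact: (svalP (stepT k (F k))).
have lim i : {l : V | forall k, nrm (sval (F k) i - l) <= 2 * (C * eps) * 4^-1 ^+ k}.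
  by apply: cid; apply: (@geometric_limit V (fun k => sval (F k) i)) => k; exact: hF.
exists (fun i => sval (lim i)) => [i|eta eta0].
  rewrite nrmC; apply: le_trans (svalP (lim i) 0%N) _.
  by rewrite [X in X <= _]mulr1 mulrA.
have [k1 hk1] := expr4V_small eps eta0.
have [k2 hk2] := expr4V_small (2 * (C * eps)) eta0.
have dec (D : R) a b : 0 <= D -> D * 4^-1 ^+ (a + b) <= D * 4^-1 ^+ a.
  move=> D0; rewrite ler_wpM2l // exprD ger_pMr ?exprn_gt0 ?invr_gt0 //.
  by rewrite exprn_ile1 ?invr_ge0 // invf_le1 // ler1n.
exists (eps * 4^-1 ^+ (k1 + k2)), (sval (F (k1 + k2)%N)); split.
- by rewrite p0 /=; apply: le_trans (dec _ _ _ _) hk1; exact: ltW.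
- exact: svalP (F (k1 + k2)%N).
- move=> i; apply: le_trans (svalP (lim i) _) _; rewrite addnC.
  apply: le_trans (dec _ _ _ _) hk2.
  by rewrite mulr_ge0 // mulr_ge0 // ltW.
Qed.

End Limits.

(** * Projections near approximate projections *)

Section Projections.
Context {R : realType} {A : cstarAlgType R}.
Implicit Types (a b e p q x : A) (eps eta : R).

Definition projection p := star p = p /\ p ** p = p.

Lemma nrm_projection p : projection p -> nrm p <= 1.
Proof.
move=> [ps pp]; have := nrm_starM p; rewrite ps pp => h.
by have := nrm_ge0 p; nra.
Qed.

Lemma idempotent_small p : p ** p = p -> nrm p < 1 -> p = 0.
Proof.
move=> pp p1; apply: nrm_le0; have := nrmM p p; rewrite pp.
by have := nrm_ge0 p; nra.
Qed.

(** Newton iteration [x |-> 3 x^2 - 2 x^3], which makes sense without a unit. With [t = x^2 - x] the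
    new defect is [4 t^3 - 3 t^2], and the displacement [t - 2 x t] is at most [5 eta] because
    [nrm x <= 2]; the sum of all displacements stays below [10 eps]. *)
Lemma near_projection a eps :
  star a = a -> 0 < eps -> eps <= 1/16 -> nrm (a ** a - a) <= eps ->
  exists2 e, projection e & nrm (e - a) <= 10 * eps.
Proof.
move=> sa eps0 epsle ha.
pose good eta (f : unit -> A) :=
  star (f tt) = f tt /\ nrm (f tt ** f tt - f tt) <= eta.
have bound x eta : star x = x -> eta <= 1/16 -> nrm (x ** x - x) <= eta -> nrm x <= 2.
  move=> sx eta1 hx; have := nrm_starM x; rewrite sx.
  have := nrm_subl (x ** x) x; have := nrm_ge0 x; nra.
have step eta (f : unit -> A) : 0 < eta -> eta <= 1/16 -> good eta f ->
    exists2 f', good (eta / 4) f' & forall i, nrm (f' i - f i) <= 5 * eta.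
  move=> eta0 eta1 [sf hf]; have xb := bound _ _ sf eta1 hf.
  set x := f tt in sf hf xb; set t := x ** x - x in hf.
  pose x' := (x ** x) *+ 3 - (x ** x ** x) *+ 2.
  have st : star t = t by rewrite /t starB starM sf.
  have t0 := nrm_ge0 t.
  exists (fun=> x') => [|[]]; last first.
    have -> : x' - f tt = t - x ** t - x ** t by rewrite /x' /t -/x; nc_ring.
    have := nrmB (t - x ** t) (x ** t); have := nrmB t (x ** t).
    by have := nrmM_le xb hf; lra.
  split; first by rewrite /x' starB !mulrS !mulr0n !addr0 !starD !starM sf cmulA.
  have -> : x' ** x' - x' = t ** t ** (t *+ 4) - t ** t *+ 3.
    by rewrite /x' /t; nc_ring.
  have tt := nrmM_le hf hf.
  have t4 : nrm (t *+ 4) <= 4 * eta.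
    by rewrite !mulrS mulr0n addr0;
      have := nrmD t (t + (t + t)); have := nrmD t (t + t); have := nrmD t t; lra.
  have ttt := nrmM_le tt t4.
  have t3 : nrm (t ** t *+ 3) <= 3 * (eta * eta).
    rewrite !mulrS mulr0n addr0; set u := t ** t in tt *.
    by have := nrmD u (u + u); have := nrmD u u; lra.
  have := nrmB (t ** t ** (t *+ 4)) (t ** t *+ 3).
  have : eta * eta <= eta * (1/16) by rewrite ler_pM2l.
  have : 0 <= eta * eta by rewrite mulr_ge0 // ltW.
  by nra.
have ga : good eps (fun=> a) by [].
have [g gf glim] := newton_limit (ler0n _ 5) step eps0 epsle ga.
exists (g tt); last by have := gf tt; lra.
have key eta : 0 < eta -> eta <= 1 -> exists x, [/\ star x = x, nrm (x ** x - x) <= eta,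
    nrm (x - g tt) <= eta & nrm x <= nrm (g tt) + 1].
  move=> eta0 eta1; have [eta' [f [/andP[_ le] [sf hf] hg]]] := glim _ eta0.
  exists (f tt); split => //; first exact: le_trans le.
  by have := nrm_subl (f tt) (g tt); have := hg tt; lra.
set y := g tt in key *.
split; apply/eqP; rewrite -subr_eq0; apply/eqP; apply: nrm_small => eta eta0.
  pose m := Num.min 1 (eta / 2).
  have m0 : 0 < m by rewrite lt_min ltr01 divr_gt0.
  have m1 : m <= 1 by rewrite ge_min lexx.
  have m2 : m <= eta / 2 by rewrite ge_min lexx orbT.
  have [x [sx _ xy _]] := key _ m0 m1.
  have -> : star y - y = star (y - x) + (x - y) by rewrite starB sx addrA subrK.
  by have := nrmD (star (y - x)) (x - y); rewrite nrm_star (nrmC y); lra.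
pose K := 2 * nrm y + 3.
have y0 := nrm_ge0 y.
have K0 : 0 < K by rewrite /K; lra.
pose m := Num.min 1 (eta / K).
have m0 : 0 < m by rewrite lt_min ltr01 divr_gt0.
have m1 : m <= 1 by rewrite ge_min lexx.
have m2 : m * K <= eta by rewrite -ler_pdivlMr // ge_min lexx orbT.
have [x [_ xx xy xb]] := key _ m0 m1.
have -> : y ** y - y = (y ** y - x ** x) + (x ** x - x) + (x - y) by nc_ring.
have := nrmM_sub y y x x; rewrite (nrmC y).
have := nrmD (y ** y - x ** x + (x ** x - x)) (x - y).
have := nrmD (y ** y - x ** x) (x ** x - x).
have := nrm_ge0 (x - y); have := nrm_ge0 x.
by rewrite /K in m2; nra.
Qed.

End Projections.

(** * Nearly invariant means on compact groups *)

Section Averages.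
Context {R : realType} {V : normedModType R[i]} {T : Type}.
Implicit Types (s : seq T) (f g : T -> V) (b D : R).

Definition avg s f : V := ((size s)%:R^-1 : R)%:C *: \sum_(x <- s) f x.

Lemma avg_le s f b : (0 < size s)%N -> (forall x, nrm (f x) <= b) -> nrm (avg s f) <= b.
Proof.
move=> s0 fb; rewrite nrmZr ger0_norm ?invr_ge0 ?ler0n //.
rewrite ler_pdivrMl ?ltr0n //; apply: le_trans (nrm_sum _ _ _) _.
elim: s {s0} => [|x s IH]; first by rewrite big_nil mul0r.
by rewrite big_cons /= -natr1 mulrDl mul1r addrC lerD.
Qed.

Lemma avgD s f g : avg s (fun x => f x + g x) = avg s f + avg s g.
Proof. by rewrite /avg big_split scalerDr. Qed.

Lemma avgN s f : avg s (fun x => - f x) = - avg s f.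
Proof. by rewrite /avg sumrN scalerN. Qed.

Lemma avgB s f g : avg s (fun x => f x - g x) = avg s f - avg s g.
Proof. by rewrite avgD avgN. Qed.

Lemma avg_const s v : (0 < size s)%N -> avg s (fun=> v) = v.
Proof.
move=> s0; rewrite /avg big_const_seq count_predT iter_addr_0 -scaler_nat scalerA.
by rewrite fmorphV rmorph_nat mulVf ?scale1r // pnatr_eq0 -lt0n.
Qed.

Lemma eq_avg s f g : f =1 g -> avg s f = avg s g.
Proof. by move=> fg; rewrite /avg (eq_bigr _ (fun x _ => fg x)). Qed.

End Averages.

Lemma avgMl {R : realType} {A : cstarAlgType R} {T : Type} (s : seq T) (a : A) f :
  avg s (fun x => a ** f x) = a ** avg s f.
Proof. by rewrite /avg cstar_scaleAr cmul_sumr. Qed.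

Lemma avgMr {R : realType} {A : cstarAlgType R} {T : Type} (s : seq T) (a : A) f :
  avg s (fun x => f x ** a) = avg s f ** a.
Proof. by rewrite /avg cstar_scaleAl cmul_suml. Qed.

Section InvariantMean.
Context {R : realType} {G : groupType}.
Variable d : G -> G -> R.

Definition bi_invariant :=
  forall x y z : G, d (z * x)%g (z * y)%g = d x y /\ d (x * z)%g (y * z)%g = d x y.

Definition precompact_dist := forall r : R, 0 < r ->
  exists s : seq G, forall x, exists2 y, y \in s & d y x <= r.

Definition dlipschitz {V : normedModType R[i]} (L : R) (f : G -> V) :=
  forall x y, nrm (f x - f y) <= L * d x y.

Hypotheses (dinv : bi_invariant) (dtb : precompact_dist).

Context {V : normedModType R[i]}.
Implicit Types (f : G -> V) (L D : R).

Lemma sum_sub_le f (x y : G) (s t : seq G) D :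
  size s = size t -> (forall g h, nrm (f g - f h) <= D) ->
  nrm (\sum_(g <- s) f (g * x)%g - \sum_(g <- t) f (g * y)%g) <= (size s)%:R * D.
Proof.
move=> + fD; elim: s t => [|g s IH] [|h t] //= => [_|[st]].
  by rewrite !big_nil subrr nrm0 mul0r.
rewrite !big_cons opprD addrACA -natr1 mulrDl mul1r addrC.
by apply: le_trans (nrmD _ _) _; apply: lerD; [exact: IH|].
Qed.

(* Averaging over an [r]-net contracts the oscillation of a function: for any
   [x], [y] the translates of the net by [x] and by [y] contain points at
   distance at most [r], and the other points are paired arbitrarily. *)
Lemma net_contracts (s : seq G) (r L D : R) f x y :
  (forall x, exists2 y, y \in s & d y x <= r) -> 0 <= L ->
  dlipschitz L f -> (forall g h, nrm (f g - f h) <= L * r + D) ->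
  nrm (avg s (fun g => f (g * x)%g) - avg s (fun g => f (g * y)%g))
    <= L * r + (1 - (size s)%:R^-1) * D.
Proof.
move=> net L0 fL fD.
case: s net => [/(_ 1%g)[]//|g1 s] net.
(* Chosen so that [g2 * x] lies within [r] of [g1 * y]. *)
have [g2 g2s dg2] := net (g1 * y / x)%g.
have N0 : 0 < (size (g1 :: s))%:R :> R by rewrite ltr0n.
rewrite -scalerBr nrmZr ger0_norm ?invr_ge0 ?ler0n //.
rewrite ler_pdivrMl // (perm_big _ (perm_to_rem g2s)) [X in nrm (_ - X)]big_cons.
rewrite [X in nrm (X - _)]big_cons opprD addrACA.
have sz : size (rem g2 (g1 :: s)) = size s by rewrite size_rem.
have h1 := sum_sub_le x y sz fD.
have h2 : nrm (f (g2 * x)%g - f (g1 * y)%g) <= L * r.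
  apply: le_trans (fL _ _) _; rewrite ler_wpM2l //.
  by have [_ <-] := dinv (g2 * x)%g (g1 * y)%g x^-1%g; rewrite mulgK.
apply: le_trans (nrmD _ _) _; apply: le_trans (lerD h2 h1) _.
rewrite sz /= -natr1 in N0 *; set N := (size s)%:R in N0 *.
have -> : (N + 1) * (L * r + (1 - (N + 1)^-1) * D) = L * r + N * (L * r + D).
  by field; rewrite gt_eqF.
exact: lexx.
Qed.

(** Repeated averaging over the net is a single average over products of net points. Each average is
    again [L]-Lipschitz, so the contraction applies anew and shrinks geometrically the part of the
    oscillation beyond [L * r]. *)
Lemma invariant_mean_osc (s0 : seq G) (r : R) m :
  (forall x, exists2 y, y \in s0 & d y x <= r) -> 0 <= r ->
  exists2 s : seq G, (0 < size s)%N & forall L D f, 0 <= L ->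
    dlipschitz L f -> (forall g h, nrm (f g - f h) <= L * r + D) ->
    forall x y, nrm (avg s (fun g => f (g * x)%g) - avg s (fun g => f (g * y)%g))
      <= L * r + (1 - (size s0)%:R^-1) ^+ m * D.
Proof.
move=> net r0; have s00 : (0 < size s0)%N by have [y] := net 1%g; case: (s0).
elim: m => [|m [s sp IH]].
  exists [:: 1%g] => // L D f L0 fL fD x y.
  by rewrite /avg invr1 !scale1r !big_seq1 !mul1g expr0 mul1r.
exists [seq (g * h)%g | h <- s, g <- s0].
  by rewrite size_allpairs muln_gt0 sp.
move=> L D f L0 fL fD x y.
have E z : avg [seq (g * h)%g | h <- s, g <- s0] (fun g => f (g * z)%g) =
    avg s (fun h => avg s0 (fun g => f (g * (h * z))%g)).
  rewrite /avg size_allpairs big_allpairs_dep -scaler_sumr scalerA.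
  rewrite -rmorphM /= -invfM natrM mulrC; congr (_ *: _).
  by do 2![apply: eq_bigr => ? _]; rewrite mulgA.
rewrite !E exprSr -mulrA.
apply: (IH _ _ (fun z => avg s0 (fun g => f (g * z)%g))) => // [g h|g h].
  rewrite -avgB; apply: avg_le => // k.
  by apply: le_trans (fL _ _) _; have [-> _] := dinv g h k.
exact: net_contracts.
Qed.

(** The set [s] is chosen before [f], so one and the same average, a linear operation, serves all
    the functions of a Newton step. *)
Theorem invariant_mean L D eta : 0 <= L -> 0 < eta ->
  exists2 s : seq G, (0 < size s)%N & forall f,
    dlipschitz L f -> (forall g, nrm (f g) <= D) ->
    forall x, nrm (avg s (fun g => f (g * x)%g) - avg s f) <= eta.
Proof.
move=> L0 eta0.
pose r := eta / (2 * (L + 1)).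
have r0 : 0 < r by rewrite divr_gt0 // mulr_gt0 //; lra.
have Lr : L * r <= eta / 2.
  have : r * (L + 1) = eta / 2 by rewrite /r; field; lra.
  by lra.
have [s0 net] := dtb r0.
have s00 : (0 < size s0)%N by have [y] := net 1%g; case: (s0).
have N01 : 0 <= (1 - (size s0)%:R^-1 : R) < 1.
  by rewrite subr_ge0 invf_le1 ?ltr0n // ler1n s00 ltrBlDr ltrDl invr_gt0 ltr0n.
have [m hm] := expr_small (2 * D) N01 (divr_gt0 eta0 (ltr0n _ 2)).
have [s sp hs] := invariant_mean_osc m net (ltW r0).
exists s => // f fL fD x.
have fosc g h : nrm (f g - f h) <= L * r + 2 * D.
  have := nrmB (f g) (f h); have := fD g; have := fD h.
  by have := mulr_ge0 L0 (ltW r0); lra.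
have := hs _ _ _ L0 fL fosc x 1%g.
rewrite (eq_avg s (fun g => congr1 f (mulg1 g))) mulrC in hm *.
by lra.
Qed.

End InvariantMean.

(** * Approximate representations *)

Section Halve.
Context {R : realType} {V : normedModType R[i]}.

Definition halve (x : V) : V := (2^-1)%:C *: x.

Lemma halve_double x : halve x + halve x = x.
Proof.
by rewrite -scalerDl -rmorphD /= (_ : 2^-1 + 2^-1 = 1 :> R) ?scale1r //; field.
Qed.

Lemma halveD x y : halve (x + y) = halve x + halve y.
Proof. exact: scalerDr. Qed.

Lemma halveN x : halve (- x) = - halve x.
Proof. exact: scalerN. Qed.

Lemma halveB x y : halve (x - y) = halve x - halve y.
Proof. exact: scalerBr. Qed.

Lemma nrm_halve x : nrm (halve x) = nrm x / 2.
Proof. by rewrite nrmZr ger0_norm ?invr_ge0 // mulrC. Qed.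

End Halve.

Section ApproximateRepresentations.
Context {R : realType} {A : cstarAlgType R} {G : groupType}.
Variable d : G -> G -> R.
Hypotheses (dinv : bi_invariant d) (dtb : precompact_dist d).
Variable e : A.
Hypothesis pe : projection e.

(** The values lie in the corner of the projection [e], which stands for the unit. The Lipschitz
    constant is left free, since it grows at each Newton step and only affects the choice of the
    finite mean. The last clause is coarse on purpose: it singles out [e] among the idempotents that
    [f 1] might be near, and a bound of order [eps] follows. *)
Definition approx_rep (eps : R) (f : G -> A) :=
  [/\ exists2 L, 0 <= L & dlipschitz d L f,
      forall g, e ** f g = f g /\ f g ** e = f g,
      forall g, f g^-1%g = star (f g),
      forall g h, nrm (f (g * h)%g - f g ** f h) <= eps &
      nrm (f 1%g - e) <= 1/2].

(** By symmetry [star (f g) ** f g] is [f g^-1 ** f g], which is near [f 1]. *)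
Lemma approx_rep_bound eps f g : eps <= 1 -> approx_rep eps f -> nrm (f g) <= 2.
Proof.
move=> eps1 [_ _ fs fd f1e].
have := nrm_starM (f g); rewrite -fs => h.
have := fd g^-1%g g; rewrite mulVg => h1.
have := nrm_subl (f g^-1%g ** f g) (f 1%g); rewrite (nrmC _ (f 1%g)) => h2.
have := nrm_subl (f 1%g) e => h3; have := nrm_projection pe.
by have := nrm_ge0 (f g); nra.
Qed.

(** With [z = e - f 1] one has [z - z ** z = f 1 - f 1 ** f 1], of norm at most [eps]; as
    [nrm z <= 1/2], the square absorbs at most half of [z]. *)
Lemma approx_rep_unit eps f : approx_rep eps f -> nrm (f 1%g - e) <= 2 * eps.
Proof.
case: pe => _ ee [_ fe _ fd f1e]; have [ef fe1] := fe 1%g.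
have := fd 1%g 1%g; rewrite mulg1 => h.
pose z := e - f 1%g.
have zz : z ** z = e - f 1%g - f 1%g + f 1%g ** f 1%g.
  by rewrite /z cmulBl !cmulBr ee ef fe1; nc_ring.
have : f 1%g - f 1%g ** f 1%g = z - z ** z by rewrite zz /z; nc_ring.
move=> h3; rewrite h3 in h; rewrite nrmC -/z in f1e *.
by have := nrm_subl z (z ** z); have := nrmM z z; have := nrm_ge0 z; nra.
Qed.

(** The defect satisfies the cocycle identity [c g (h k) + f g ** c h k = c (g h) k + c g h ** f k],
    so the mean over [h] of [f h^-1 ** c h g] exhibits [c] as a coboundary up to second order.
    Beside [b g ** b k] there are three errors: [t1], as [f h^-1 ** f h] is not exactly [e]; [t2],
    as the mean is not exactly invariant; [t3], a mean of products of two defects. *)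
Lemma approx_rep_newton eps f : 0 < eps -> eps <= 1/100 -> approx_rep eps f ->
  exists2 f', approx_rep (eps / 4) f' & forall g, nrm (f' g - f g) <= 2 * eps.
Proof.
move=> eps0 epsle fr; have eps1 : eps <= 1 by lra.
have fb g : nrm (f g) <= 2 := approx_rep_bound g eps1 fr.
have f1e := approx_rep_unit fr.
case: fr => -[L L0 fL] fe fs fd _; case: (pe) => es ee.
pose c g h := f (g * h)%g - f g ** f h.
have ec g h : e ** c g h = c g h by rewrite /c cmulBr cmulA !(fe _).1.
have ce g h : c g h ** e = c g h by rewrite /c cmulBl -cmulA !(fe _).2.
have cb g h : nrm (c g h) <= eps := fd g h.
have fLr k x y : nrm (f (x * k)%g - f (y * k)%g) <= L * d x y.
  by have [_ <-] := dinv x y k; exact: fL.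
have fLl k x y : nrm (f (k * x)%g - f (k * y)%g) <= L * d x y.
  by have [<- _] := dinv x y k; exact: fL.
have fLV k x y : nrm (f (k * x^-1)%g - f (k * y^-1)%g) <= L * d x y.
  rewrite nrmC; apply: le_trans (fLl _ _ _) _; rewrite ler_wpM2l //.
  have [<- _] := dinv y^-1%g x^-1%g y; have [_ <-] := dinv (y * y^-1)%g (y * x^-1)%g x.
  by rewrite mulgV mul1g mulgVK.
(* [F g k (h g)] is [f h^-1 ** c (h g) k]; near invariance of the mean trades it for [F g k h]. *)
pose F g k h := f (g * h^-1)%g ** c h k.
have FL g k : dlipschitz d (7 * L) (F g k).
  move=> x y; apply: le_trans (nrmM_sub _ _ _ _) _.
  have h1 := fLV g x y.
  have h2 : nrm (c x k - c y k) <= 3 * (L * d x y).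
    rewrite /c.
    have -> : f (x * k)%g - f x ** f k - (f (y * k)%g - f y ** f k) =
        (f (x * k)%g - f (y * k)%g) - (f x - f y) ** f k by nc_ring.
    have := nrmB (f (x * k)%g - f (y * k)%g) ((f x - f y) ** f k).
    by have := nrmM_le (fL x y) (fb k); have := fLr k x y; lra.
  have h3 := le_trans (fd x k) eps1; have h4 := fb (g * y^-1)%g.
  have h5 := nrm_ge0 (f (g * x^-1)%g - f (g * y^-1)%g).
  have h6 := nrm_ge0 (c x k - c y k).
  have h7 := nrm_ge0 (c x k); have h8 := nrm_ge0 (f (g * y^-1)%g).
  have h9 := ler_pM h5 h7 h1 h3; have h10 := ler_pM h8 h6 h4 h2.
  by rewrite -/(c x k) in h9 *; lra.
have Fb g k h : nrm (F g k h) <= 2 by rewrite -[2]mulr1; apply: nrmM_le => //; apply: le_trans (fd _ _) eps1.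
have L7 : 0 <= 7 * L by rewrite mulr_ge0.
have ee0 : 0 < eps * eps by rewrite mulr_gt0.
have [s sp hs] := invariant_mean dinv dtb (V := A) 2 L7 ee0.
pose b g := avg s (fun h => f h^-1%g ** c h g).
have bb g : nrm (b g) <= 2 * eps by apply: avg_le => // h; apply: nrmM_le.
pose f1 g := f g + b g.
have f1d g k : nrm (f1 (g * k)%g - f1 g ** f1 k) <= 9 * (eps * eps).
  pose t1 := avg s (fun h => (e - f 1%g + c h^-1%g h) ** c g k).
  pose t2 := avg s (fun h => F g k (h * g)%g) - avg s (F g k).
  pose t3 := avg s (fun h => c g h^-1%g ** c h k).
  have E : f1 (g * k)%g - f1 g ** f1 k = t1 + t2 + t3 - b g ** b k.
    have : t1 + t2 + t3 = c g k + b (g * k)%g - b g ** f k - f g ** b k.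
      transitivity (avg s (fun h => c g k + f h^-1%g ** c h (g * k)%g -
          (f h^-1%g ** c h g) ** f k - f g ** (f h^-1%g ** c h k))); last first.
        by rewrite avgB avgB avgD avg_const // avgMr avgMl.
      rewrite /t1 /t2 /t3 -!(avgB, avgD); apply: eq_avg => h; rewrite /F.
      have -> : (e - f 1%g + c h^-1%g h) ** c g k = c g k - f h^-1%g ** f h ** c g k.
        have -> : c h^-1%g h = f 1%g - f h^-1%g ** f h by rewrite /c mulVg.
        by rewrite -[X in _ = X - _]ec; nc_ring.
      rewrite invgM mulVKg /c (mulgA h g k); nc_ring.
    by move=> ->; rewrite /f1 /c; nc_ring.
  have h1 : nrm t1 <= 3 * eps * eps.
    apply: avg_le => // h; apply: nrmM_le => //.
    have := nrmD (e - f 1%g) (c h^-1%g h); rewrite (nrmC e).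
    by have := cb h^-1%g h; lra.
  have h2 : nrm t2 <= eps * eps by exact: hs.
  have h3 : nrm t3 <= eps * eps by apply: avg_le => // h; exact: nrmM_le.
  have h4 := nrmM_le (bb g) (bb k).
  rewrite E; have := nrmB (t1 + t2 + t3) (b g ** b k).
  by have := nrmD (t1 + t2) t3; have := nrmD t1 t2; lra.
have eb g : e ** b g = b g.
  by rewrite /b -avgMl; apply: eq_avg => h; rewrite cmulA (fe _).1.
have be g : b g ** e = b g.
  by rewrite /b -avgMr; apply: eq_avg => h; rewrite -cmulA ce.
have ef1 g : e ** f1 g = f1 g by rewrite /f1 cstar_mulDr eb (fe _).1.
have f1e' g : f1 g ** e = f1 g by rewrite /f1 cstar_mulDl be (fe _).2.
have f1L : dlipschitz d (7 * L) f1.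
  move=> x y.
  have -> : f1 x - f1 y = (f x - f y) + (b x - b y) by rewrite /f1; nc_ring.
  apply: le_trans (nrmD _ _) _.
  suff : nrm (b x - b y) <= 2 * (3 * (L * d x y)) by have := fL x y; lra.
  rewrite /b -avgB; apply: avg_le => // h; rewrite -cmulBr; apply: nrmM_le => //.
  have -> : c h x - c h y = (f (h * x)%g - f (h * y)%g) - f h ** (f x - f y).
    by rewrite /c; nc_ring.
  have := nrmB (f (h * x)%g - f (h * y)%g) (f h ** (f x - f y)).
  by have := nrmM_le (fb h) (fL x y); have := fLl h x y; lra.
(* The mean of [f1] and its adjoint is symmetric, and its defect exceeds that of
   [f1] only by the square of their distance. *)
pose u g := halve (f1 g); pose v g := halve (star (f1 g^-1%g)).
have uE g : u g = halve (f g) + halve (b g) by rewrite -halveD.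
have vE g : v g = halve (f g) + halve (star (b g^-1%g)).
  by rewrite -halveD /v /f1 starD fs starK.
have uvB g : u g + v g - f g = halve (b g) + halve (star (b g^-1%g)).
  by rewrite uE vE -{3}(halve_double (f g)); nc_ring.
have uv g : nrm (u g - v g) <= 2 * eps.
  have -> : u g - v g = halve (b g) - halve (star (b g^-1%g)).
    by rewrite uE vE; nc_ring.
  have := nrmB (halve (b g)) (halve (star (b g^-1%g))); rewrite !nrm_halve nrm_star.
  by have := bb g; have := bb g^-1%g; lra.
have uvf g : nrm (u g + v g - f g) <= 2 * eps.
  rewrite uvB; have := nrmD (halve (b g)) (halve (star (b g^-1%g))).
  rewrite !nrm_halve nrm_star.
  by have := bb g; have := bb g^-1%g; lra.
exists (fun g => u g + v g) => //; split.
- exists (7 * L) => // x y.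
  have -> : u x + v x - (u y + v y) =
      halve (f1 x - f1 y) + halve (star (f1 x^-1%g - f1 y^-1%g)).
    by rewrite starB !halveB /u /v; nc_ring.
  apply: le_trans (nrmD _ _) _; rewrite !nrm_halve nrm_star.
  have := f1L x y; have := f1L y^-1%g x^-1%g; rewrite (nrmC (f1 y^-1%g)).
  have [<- _] := dinv y^-1%g x^-1%g y; have [_ <-] := dinv (y * y^-1)%g (y * x^-1)%g x.
  by rewrite mulgV mul1g mulgVK; lra.
- move=> g; rewrite /u /v -halveD /halve.
  rewrite cstar_scaleAr cstar_scaleAl cstar_mulDr cstar_mulDl ef1 f1e'.
  have esf h : e ** star (f1 h) = star (f1 h) by rewrite -{1}es -starM f1e'.
  have sfe h : star (f1 h) ** e = star (f1 h) by rewrite -{1}es -starM ef1.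
  by rewrite esf sfe.
- move=> g; rewrite /u /v invgK -!halveD /halve.
  rewrite starZr (starD (f1 g)) starK; congr (_ *: _).
  by rewrite addrC.
(* The total is [(9 + 4) eps^2], at most [eps / 4] since [eps <= 1/100]. *)
- move=> g h.
  have scale x y : halve (x ** y) = halve x ** (halve y + halve y).
    by rewrite halve_double /halve cstar_scaleAl.
  have -> : u (g * h)%g + v (g * h)%g - (u g + v g) ** (u h + v h) =
      halve (f1 (g * h)%g - f1 g ** f1 h)
      + halve (star (f1 (g * h)^-1%g - f1 h^-1%g ** f1 g^-1%g))
      + (u g - v g) ** (u h - v h).
    by rewrite starB starM !halveB !scale /u /v; nc_ring.
  have h1 := f1d g h; have h2 := f1d h^-1%g g^-1%g; rewrite -invgM in h2.
  have h3 := nrmM_le (uv g) (uv h).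
  apply: le_trans (nrmD _ _) _; have := nrmD (halve (f1 (g * h)%g - f1 g ** f1 h))
    (halve (star (f1 (g * h)^-1%g - f1 h^-1%g ** f1 g^-1%g))).
  rewrite !nrm_halve nrm_star => h4.
  have : eps * eps <= eps * (1/100) by rewrite ler_pM2l.
  by lra.
- have := nrm_sub (f 1%g) (u 1%g + v 1%g) e; have := uvf 1%g; lra.
Qed.

(** Only algebraic identities pass to the limit: the Lipschitz constants of the approximants are not
    controlled, so no continuity of [rho] is obtained. *)
Theorem approx_rep_stability eps f : 0 < eps -> eps <= 1/100 -> approx_rep eps f ->
  exists rho : G -> A,
    [/\ forall g h, rho (g * h)%g = rho g ** rho h,
        forall g, rho g^-1%g = star (rho g),
        rho 1%g = e & forall g, nrm (rho g - f g) <= 4 * eps].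
Proof.
move=> eps0 epsle fr.
have [rho rhof lim] := newton_limit (ler0n _ 2) approx_rep_newton eps0 epsle fr.
have key eta : 0 < eta -> eta <= 1/100 -> exists h, [/\ forall g, nrm (h g - rho g) <= eta,
    forall g, nrm (h g) <= 2, forall x y, nrm (h (x * y)%g - h x ** h y) <= eta,
    forall g, h g^-1%g = star (h g) & nrm (h 1%g - e) <= 2 * eta].
  move=> eta0 eta1; have [eps' [h [/andP[_ le] hr hg]]] := lim _ eta0.
  exists h; split => //.
  - move=> g; apply: (approx_rep_bound g _ hr); lra.
  - by case: hr => _ _ _ hd _ x y; apply: le_trans (hd _ _) le.
  - by case: hr.
  - by have := approx_rep_unit hr; lra.
have small (z : A) (K : R) : 0 < K -> (forall eta, 0 < eta -> eta <= 1/100 ->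
    nrm z <= K * eta) -> z = 0.
  move=> K0 hz; apply: nrm_small => eta eta0.
  pose m := Num.min (1/100) (eta / K).
  have m0 : 0 < m by rewrite lt_min !divr_gt0.
  have m1 : m <= 1/100 by rewrite ge_min lexx.
  have m2 : K * m <= eta by rewrite mulrC -ler_pdivlMr // ge_min lexx orbT.
  by apply: le_trans (hz _ m0 m1) m2.
exists rho; split.
- move=> x y; apply/eqP; rewrite -subr_eq0; apply/eqP.
  apply: (small _ 7) => // eta eta0 eta1.
  have [h [hr hb hd _ _]] := key _ eta0 eta1.
  have -> : rho (x * y)%g - rho x ** rho y = - (h (x * y)%g - rho (x * y)%g)
    + (h (x * y)%g - h x ** h y) + (h x ** h y - rho x ** rho y) by nc_ring.
  have rb : nrm (rho x) <= 3.
    by have := nrm_subl (rho x) (h x); rewrite (nrmC (rho x)); have := hr x; have := hb x; lra.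
  have h1 := nrmM_sub (h x) (h y) (rho x) (rho y).
  have h2 := ler_pM (nrm_ge0 _) (nrm_ge0 _) (hr x) (hb y).
  have h3 := ler_pM (nrm_ge0 _) (nrm_ge0 _) rb (hr y).
  apply: le_trans (nrmD _ _) _.
  have := nrmD (- (h (x * y)%g - rho (x * y)%g)) (h (x * y)%g - h x ** h y).
  rewrite nrmN; have := hr (x * y)%g; have := hd x y.
  by lra.
- move=> g; apply/eqP; rewrite -subr_eq0; apply/eqP.
  apply: (small _ 2) => // eta eta0 eta1.
  have [h [hr _ _ hs _]] := key _ eta0 eta1.
  have -> : rho g^-1%g - star (rho g) = - (h g^-1%g - rho g^-1%g) + star (h g - rho g).
    by rewrite hs starB; nc_ring.
  have := nrmD (- (h g^-1%g - rho g^-1%g)) (star (h g - rho g)).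
  by rewrite nrmN nrm_star; have := hr g; have := hr g^-1%g; lra.
- apply/eqP; rewrite -subr_eq0; apply/eqP.
  apply: (small _ 3) => // eta eta0 eta1.
  have [h [hr _ _ _ h1]] := key _ eta0 eta1.
  have := nrm_sub (h 1%g) (rho 1%g) e; rewrite (nrmC (rho 1%g) (h 1%g)).
  by have := hr 1%g; lra.
- by move=> g; have := rhof g; lra.
Qed.

End ApproximateRepresentations.

(** * Lipschitz approximation of nearly continuous maps *)

Section LipschitzApproximation.
Context {R : realType} {G : groupType} {V : normedModType R[i]}.
Variable d : G -> G -> R.
Hypotheses (dsym : forall x y, d x y = d y x)
  (dtri : forall x y z, d x z <= d x y + d y z)
  (dtb : precompact_dist d).

(** A partition of unity on an [eta]-net: the tents [k y] vanish at distance [2 * eta] from [y], and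
    their sum [S] is at least [eta] everywhere. The value at [u] is a convex combination of values
    [f y] with [y] within [2 * eta] of [u]. *)
Lemma lipschitz_approximation (f : G -> V) (B theta eta : R) :
  0 < eta -> (forall x, nrm (f x) <= B) ->
  (forall x y, d x y <= 2 * eta -> nrm (f x - f y) <= theta) ->
  exists2 f' : G -> V, exists2 L, 0 <= L & dlipschitz d L f' &
    forall x, nrm (f' x - f x) <= theta.
Proof.
move=> eta0 fB ftheta; have [s net] := dtb eta0.
have B0 : 0 <= B by apply: le_trans (fB 1%g); exact: nrm_ge0.
pose k y u := Num.max 0 (2 * eta - d y u).
have k0 y u : 0 <= k y u by rewrite le_max lexx.
have kd y u v : `|k y u - k y v| <= d u v.
  have := dtri y u v; have := dtri y v u; rewrite (dsym v u).
  rewrite ler_norml /k /Order.max => h1 h2; apply/andP.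
  case: (ltP 0 (2 * eta - d y u)) => ?; case: (ltP 0 (2 * eta - d y v)) => ?; split; lra.
pose S u := \sum_(y <- s) k y u; pose N u := \sum_(y <- s) (k y u)%:C *: f y.
have Seta u : eta <= S u.
  have [y ys dy] := net u.
  rewrite /S (perm_big _ (perm_to_rem ys)) big_cons /=.
  have : 0 <= \sum_(z <- rem y s) k z u by apply: sumr_ge0.
  have : eta <= k y u by rewrite le_max; apply/orP; right; lra.
  lra.
have S0 u : 0 < S u by apply: lt_le_trans (Seta u).
have sumd (F : G -> R) D : (forall y, F y <= D) -> \sum_(y <- s) F y <= (size s)%:R * D.
  move=> FD; rewrite mulr_natl -[X in _ *+ X]count_predT -iter_addr_0 -big_const_seq.
  exact: ler_sum.
have Sd u v : `|S u - S v| <= (size s)%:R * d u v.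
  rewrite /S -sumrB; apply: le_trans (ler_norm_sum _ _ _) _.
  by apply: sumd => y; exact: kd.
have Nd u v : nrm (N u - N v) <= (size s)%:R * (d u v * B).
  rewrite /N -sumrB; apply: le_trans (nrm_sum _ _ _) _.
  apply: sumd => y; rewrite -scalerBl -rmorphB nrmZr.
  by apply: ler_pM => //; exact: nrm_ge0.
have NB u : nrm (N u) <= S u * B.
  apply: le_trans (nrm_sum _ _ _) _; rewrite /S mulr_suml.
  apply: ler_sum => y _; rewrite nrmZr ger0_norm // ler_wpM2l //.
exists (fun u => ((S u)^-1)%:C *: N u).
  exists (2 * ((size s)%:R * B / eta)).
    by rewrite mulr_ge0 // divr_ge0 ?mulr_ge0 // ltW.
  move=> u v.
  have -> : ((S u)^-1)%:C *: N u - ((S v)^-1)%:C *: N v =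
      ((S u)^-1)%:C *: (N u - N v) + ((S u)^-1 - (S v)^-1)%:C *: N v.
    by rewrite scalerBr rmorphB scalerBl addrA subrK.
  apply: le_trans (nrmD _ _) _; rewrite !nrmZr.
  rewrite [X in X * _ + _]ger0_norm ?invr_ge0 ?(ltW (S0 _)) //.
  have D0 : 0 <= (size s)%:R * (d u v * B) by apply: le_trans (Nd u v); exact: nrm_ge0.
  have h1 : (S u)^-1 * nrm (N u - N v) <= eta^-1 * ((size s)%:R * (d u v * B)).
    apply: ler_pM => //; rewrite ?invr_ge0 ?nrm_ge0 ?(ltW (S0 _)) //.
    by rewrite lef_pV2 // posrE.
  have h2 : `|(S u)^-1 - (S v)^-1| * nrm (N v) <= eta^-1 * ((size s)%:R * (d u v * B)).
    have -> : (S u)^-1 - (S v)^-1 = (S u)^-1 * (S v - S u) * (S v)^-1.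
      by field; rewrite !gt_eqF.
    have Su0 : 0 <= (S u)^-1 by rewrite invr_ge0 ltW.
    have Sv0 : 0 <= (S v)^-1 by rewrite invr_ge0 ltW.
    rewrite !normrM (ger0_norm Su0) (ger0_norm Sv0).
    have h3 : (S v)^-1 * nrm (N v) <= B by rewrite ler_pdivrMl.
    have h4 := Sd u v; rewrite distrC in h4.
    rewrite -[X in X <= _]mulrA -[X in X <= _]mulrA.
    apply: ler_pM => //; rewrite ?mulr_ge0 ?nrm_ge0 //.
      by rewrite lef_pV2 // posrE.
    by rewrite [X in _ <= X]mulrA; apply: ler_pM => //; rewrite mulr_ge0 ?nrm_ge0.
  apply: le_trans (lerD h1 h2) _; rewrite le_eqVlt; apply/orP; left; apply/eqP.
  by ring.
move=> u.
have -> : ((S u)^-1)%:C *: N u - f u =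
    ((S u)^-1)%:C *: \sum_(y <- s) (k y u)%:C *: (f y - f u).
  under eq_bigr do rewrite scalerBr.
  rewrite sumrB -scaler_suml -rmorph_sum scalerBr scalerA -rmorphM.
  by rewrite mulVf ?scale1r // gt_eqF.
rewrite nrmZr ger0_norm ?invr_ge0 ?(ltW (S0 _)) // ler_pdivrMl //.
apply: le_trans (nrm_sum _ _ _) _; rewrite /S mulr_suml; apply: ler_sum => y _.
rewrite nrmZr ger0_norm //.
have [->|kn0] := eqVneq (k y u) 0; first by rewrite !mul0r.
rewrite ler_wpM2l //; apply: ftheta; rewrite leNgt; apply/negP => h.
by move: kn0; rewrite /k max_l ?eqxx //; lra.
Qed.

End LipschitzApproximation.

(** * Finite-dimensional C*-algebras *)

Lemma normc_le_ReIm {R : realType} (z : R[i]) :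
  complex.Re `|z| <= `|complex.Re z| + `|complex.Im z|.
Proof.
case: z => a b; rewrite normc_def /=.
have s0 : 0 <= `|a| + `|b| by rewrite addr_ge0.
rewrite -[X in _ <= X](ger0_norm s0) -sqrtr_sqr; apply: ler_wsqrtr.
rewrite -(real_normK (num_real a)) -(real_normK (num_real b)).
by have := mulr_ge0 (normr_ge0 a) (normr_ge0 b); move: `|a| `|b| => x y ?; lra.
Qed.

Section FiniteDimension.
Import numFieldNormedType.Exports.
Context {R : realType} {V : normedModType R[i]} {n : nat}.
Variable c : 'rV[R[i]]_n -> V.
Hypotheses (clin : linear c) (cinj : injective c).

(** Real coordinates, because compactness and the extreme value theorem are applied to real row
    vectors. *)
Definition complex_row (w : 'rV[R]_(n + n)) : 'rV[R[i]]_n :=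
  \row_j (lsubmx w 0 j +i* rsubmx w 0 j).

Definition real_coord (w : 'rV[R]_(n + n)) : V := c (complex_row w).

Lemma coord_le_norm m (w : 'rV[R]_m) k : `|w 0 k| <= `|w|.
Proof.
rewrite [leRHS]/Num.norm /= mx_normrE; apply/bigmax_geP; right => /=.
by exists (0, k).
Qed.

Lemma real_coordD v w : real_coord (v + w) = real_coord v + real_coord w.
Proof.
rewrite /real_coord -[c (complex_row v)]scale1r -clin; congr c.
by apply/rowP => j; rewrite !mxE mul1r.
Qed.

Lemma real_coordZ r w : real_coord (r *: w) = r%:C *: real_coord w.
Proof.
have c0 : c 0 = 0 by have := clin (-1) 0 0; rewrite scaler0 addr0 scaleN1r addNr.
rewrite /real_coord -[RHS]addr0 -c0 -clin addr0; congr c.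
by apply/rowP => j; rewrite !mxE; simpc.
Qed.

Lemma real_coordB v w : real_coord (v - w) = real_coord v - real_coord w.
Proof. by rewrite -[- w]scaleN1r real_coordD real_coordZ rmorphN1 scaleN1r. Qed.

Lemma real_coord_eq0 w : real_coord w = 0 -> w = 0.
Proof.
have z : real_coord 0 = 0 by have := real_coordZ 0 0; rewrite !scale0r.
move=> h; have : complex_row w = complex_row 0.
  by apply: cinj; rewrite -/(real_coord w) h -/(real_coord 0) z.
move=> /rowP e; apply/rowP => k; rewrite mxE.
by case: (split_ordP k) => j ->; have := e j; rewrite !mxE => -[].
Qed.

Lemma complex_rowK v : exists w, complex_row w = v.
Proof.
exists (row_mx (\row_j complex.Re (v 0 j)) (\row_j complex.Im (v 0 j))).
by apply/rowP => j; rewrite mxE row_mxKl row_mxKr !mxE; case: (v 0 j).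
Qed.

Lemma real_coord_le : exists2 K, 0 <= K & forall w, nrm (real_coord w) <= K * `|w|.
Proof.
exists (\sum_j 2 * nrm (c (delta_mx 0 j))).
  by apply: sumr_ge0 => j _; rewrite mulr_ge0 // nrm_ge0.
move=> w.
have -> : real_coord w = \sum_j (complex_row w 0 j) *: c (delta_mx 0 j).
  have cD x y : c (x + y) = c x + c y by have := clin 1 x y; rewrite !scale1r.
  have c0 : c 0 = 0 by have := clin (-1) 0 0; rewrite scaler0 addr0 scaleN1r addNr.
  have cZ a x : c (a *: x) = a *: c x by have := clin a x 0; rewrite !addr0 c0 addr0.
  rewrite /real_coord {1}(row_sum_delta (complex_row w)).
  by rewrite (big_morph c cD c0); apply: eq_bigr => j _.
apply: le_trans (nrm_sum _ _ _) _; rewrite mulr_suml; apply: ler_sum => j _.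
rewrite nrmZ mulrAC ler_wpM2r ?nrm_ge0 //.
apply: le_trans (normc_le_ReIm _) _; rewrite !mxE /=.
by have := coord_le_norm w (lshift n j); have := coord_le_norm w (rshift n j); lra.
Qed.

(** On the unit sphere of the coordinate space, which is compact, [nrm (real_coord w)] attains its
    minimum, and injectivity of the coordinates makes it positive. *)
Lemma coord_bounded : exists2 M, 0 < M & forall w, `|w| <= M * nrm (real_coord w).
Proof.
have [[w0 w00]|h] := pselect (exists w : 'rV[R]_(n + n), w != 0); last first.
  exists 1 => // w; suff -> : w = 0 by rewrite normr0 mul1r nrm_ge0.
  by apply: contrapT => /eqP w0; apply: h; exists w.
have [K K0 hK] := real_coord_le.
pose S := [set w : 'rV[R]_(n + n) | `|w| = 1]%classic.
have normalize w : w != 0 -> S (`|w|^-1 *: w).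
  by move=> wn0; rewrite /S /= normrZ normfV normr_id mulVf // normr_eq0.
have cS : compact S.
  apply: bounded_closed_compact.
    by exists 1; split => // x x1 w /= ->; exact: ltW.
  have -> : S = (Num.norm @^-1` [set 1 : R])%classic by [].
  by apply: preimage_closed => [w _|]; [exact: norm_continuous|exact: closed_eq].
have cN : continuous (fun w => nrm (real_coord w) : R^o).
  move=> w; apply/(cvgrPdist_le (FF := nbhs_filter w)) => e e0; apply/nbhs_ballP.
  exists (e / (K + 1)); first by apply: divr_gt0 => //; lra.
  move=> v; rewrite mx_norm_ball /ball_ /= => /ltW h2.
  have h1 : `|nrm (real_coord w) - nrm (real_coord v)| <= K * `|w - v|.
    apply: le_trans (hK _); rewrite real_coordB ler_norml.
    have := nrm_subl (real_coord w) (real_coord v).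
    have := nrm_subl (real_coord v) (real_coord w); rewrite (nrmC (real_coord v)).
    by move=> ? ?; apply/andP; split; lra.
  apply: le_trans h1 _; apply: le_trans (ler_wpM2l K0 h2) _.
  by rewrite mulrCA ger_pMr // ler_pdivrMr; lra.
have [w1 /set_mem w1S w1min] := EVT_min_rV (ex_intro _ _ (normalize w0 w00)) cS
  (continuous_subspaceT cN).
have m0 : 0 < nrm (real_coord w1).
  rewrite lt_def nrm_ge0 andbT; apply/eqP => /nrm0_eq0/real_coord_eq0 w10.
  by move: w1S; rewrite /S /= w10 normr0 => /eqP; rewrite eq_sym oner_eq0.
exists (nrm (real_coord w1))^-1; first by rewrite invr_gt0.
move=> w; have [->|wn0] := eqVneq w 0.
  by rewrite normr0 mulr_ge0 ?nrm_ge0 // invr_ge0 ltW.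
have /mem_set/w1min := normalize w wn0.
rewrite real_coordZ nrmZr normfV normr_id.
by rewrite ler_pdivlMl ?normr_gt0 // mulrC ler_pdivlMl.
Qed.

(** The coordinates range over a box of side [2 * M], cut into cells of side [h]. One point is
    picked in each cell that meets the family, so the net consists of members of the family: a net
    of unitaries is made of unitaries. *)
Theorem finite_net (T : eqType) (v : T -> V) r :
  bijective c -> 0 < r -> (forall x, nrm (v x) <= 1) ->
  exists s : seq T, forall x, exists2 y, y \in s & nrm (v y - v x) <= r.
Proof.
move=> [c' cK c'K] r0 v1.
have [K K0 hK] := real_coord_le; have [M M0 hM] := coord_bounded.
have coordP x : {w | real_coord w = v x}.
  by apply: cid; have [w hw] := complex_rowK (c' (v x)); exists w; rewrite /real_coord hw c'K.
pose w x := sval (coordP x); have wE x : real_coord (w x) = v x := svalP (coordP x).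
pose h := r / (K + 1).
have h0 : 0 < h by apply: divr_gt0 => //; lra.
have wM x : `|w x| <= M by apply: le_trans (hM _) _; rewrite wE ger_pMr.
pose N := Num.truncn (2 * M / h).
pose cell x : {ffun 'I_(n + n) -> 'I_N.+1} :=
  [ffun k => inord (Num.truncn ((w x 0 k + M) / h))].
have w0 x k : 0 <= (w x 0 k + M) / h <= 2 * M / h.
  have := le_trans (coord_le_norm (w x) k) (wM x); rewrite ler_norml => /andP[? ?].
  by rewrite divr_ge0 ?ler_pM2r ?invr_gt0 //; lra.
have cellE x y : cell x = cell y -> nrm (v x - v y) <= r.
  move=> /ffunP e; rewrite -!wE -real_coordB; apply: le_trans (hK _) _.
  have h1 : `|w x - w y| <= h.
    rewrite [leLHS]/Num.norm /= mx_normrE; apply/bigmax_leP; split => [|[i k] _ /=]; first exact: ltW.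
    rewrite ord1 !mxE; have := e k; rewrite !ffunE => /(congr1 val) /=.
    have /andP[x0 x1] := w0 x k; have /andP[y0 y1] := w0 y k.
    rewrite !inordK ?ltnS ?le_truncn // => e1.
    have /andP[] := truncn_itv x0; have /andP[] := truncn_itv y0; rewrite e1 -natr1.
    have -> : w x 0 k - w y 0 k = ((w x 0 k + M) / h - (w y 0 k + M) / h) * h.
      by field; rewrite gt_eqF.
    move: (_ / h) ((w x 0 k + M) / h) => Y X ? ? ? ?.
    rewrite normrM (gtr0_norm h0) ger_pMl // ler_norml.
    by apply/andP; split; lra.
  apply: le_trans (ler_wpM2l K0 h1) _.
  by rewrite /h mulrCA ger_pMr // ler_pdivrMr; lra.
pose rep j : option T := if pselect (exists x, cell x = j) is left e
  then Some (projT1 (cid e)) else None.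
exists (pmap rep (enum {: {ffun 'I_(n + n) -> 'I_N.+1}})) => x.
have [y ry ey] : exists2 y, rep (cell x) = Some y & cell y = cell x.
  rewrite /rep; case: pselect => [e|[]]; last by exists x.
  by exists (projT1 (cid e)) => //; case: cid.
exists y; last exact: cellE.
by rewrite mem_pmap -ry map_f // mem_enum.
Qed.

End FiniteDimension.

(** * Spectral theory of normal elements and existence of a unit *)

Section SpectralDecomposition.
Context {R : realType} {F : cstarAlgType R}.
Implicit Types (a x y z : F) (l m : R[i]).

Let C := R[i].

(* Right multiplication by [a - l], written without a unit. *)
Definition rmulB a l y : F := y ** a - l *: y.

(** For normal [a], the element [b = y (a - l)] and its analogue for [star a] have the same
    [b ** star b]. *)
Lemma rmulB_star a l y : star a ** a = a ** star a ->
  rmulB a l y = 0 -> rmulB (star a) (Num.conj l) y = 0.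
Proof.
move=> na h; apply: Mstar_eq0.
have -> : rmulB (star a) (Num.conj l) y ** star (rmulB (star a) (Num.conj l) y) =
    rmulB a l y ** star (rmulB a l y).
  rewrite /rmulB !starB !starZ !starM !starK conjCK.
  rewrite !(cmulBl, cmulBr, cstar_scaleAl, cstar_scaleAr, scalerBr, scalerA).
  rewrite !cmulA -(cmulA y (star a) a) na !cmulA.
  rewrite (mulrC l); nc_ring.
by rewrite h cmul0r.
Qed.

(** If [b = y (a - l)] is killed by [a - l], it is killed by the adjoint of [a - l] as well, and
    then [b ** star b = 0]. So right multiplication by a normal element is semisimple. *)
Lemma rmulB_reduced a l y : star a ** a = a ** star a ->
  rmulB a l (rmulB a l y) = 0 -> rmulB a l y = 0.
Proof.
move=> na /(rmulB_star na) h; set b := rmulB a l y in h *.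
apply: Mstar_eq0; rewrite {2}/b /rmulB starB starZ starM cmulBr cstar_scaleAr.
by rewrite cmulA -cstar_scaleAl -cmulBl -/(rmulB _ _ b) h cmul0r.
Qed.

Lemma rmulBB a l x y : rmulB a l (x - y) = rmulB a l x - rmulB a l y.
Proof. by rewrite /rmulB cmulBl scalerBr; nc_ring. Qed.

Lemma rmulB_sum (I : Type) (s : seq I) (P : pred I) (f : I -> F) a l :
  rmulB a l (\sum_(i <- s | P i) f i) = \sum_(i <- s | P i) rmulB a l (f i).
Proof. by rewrite /rmulB cmul_suml scaler_sumr sumrB. Qed.

Lemma rmulBZ a l k y : rmulB a l (k *: y) = k *: rmulB a l y.
Proof. by rewrite /rmulB scalerBr cstar_scaleAl !scalerA mulrC. Qed.

(** Induction on the factors. If [y (a - l)] is a sum of eigenvectors [z m], those with [m != l],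
    divided by [m - l], form a part of [y]. The remainder [x] satisfies [x (a - l)^2 = 0], so it is
    an eigenvector for [l]. *)
Lemma eigen_split a y (s : seq C) : star a ** a = a ** star a ->
  foldl (fun y l => rmulB a l y) y s = 0 ->
  exists (t : seq C) (z : C -> F), [/\ uniq t, y = \sum_(l <- t) z l &
    forall l, z l ** a = l *: z l].
Proof.
move=> na; elim: s y => [|l s IH] y /=.
  move=> ->; exists [::], (fun=> 0); split; rewrite ?big_nil // => l.
  by rewrite cmul0r scaler0.
move=> /IH[t [z [ut yE zE]]].
have zl m : rmulB a l (z m) = (m - l) *: z m by rewrite /rmulB zE scalerBl.
pose t' := [seq m <- t | m != l]; pose w m := (m - l)^-1 *: z m.
pose x := y - \sum_(m <- t') w m.
have wE m : m != l -> rmulB a l (w m) = z m.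
  by move=> ml; rewrite rmulBZ zl scalerA mulVf ?scale1r // subr_eq0.
have xE : rmulB a l x = if l \in t then z l else 0.
  rewrite rmulBB yE rmulB_sum big_filter.
  rewrite (eq_bigr z wE).
  case: ifP => lt; last first.
    rewrite -big_filter (_ : [seq _ <- _ | _] = t) ?subrr //.
    by apply/all_filterP/allP => m mt; apply: contraFneq lt => <-.
  rewrite (perm_big _ (perm_to_rem lt)) big_cons /=.
  rewrite (rem_filter _ ut) big_filter [X in _ - X](perm_big _ (perm_to_rem lt)).
  rewrite big_cons eqxx /= (rem_filter _ ut) big_filter_cond.
  rewrite [X in _ - X](eq_bigl (fun m => m != l)) ?addrK // => m.
  by rewrite andbb.
have xl : rmulB a l x = 0.
  apply: rmulB_reduced => //; rewrite xE; case: ifP => _; first by rewrite zl subrr scale0r.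
  by rewrite /rmulB cmul0r scaler0 subr0.
exists (l :: t'), (fun m => if m == l then x else w m); split.
- by rewrite /= mem_filter eqxx filter_uniq.
- rewrite big_cons eqxx big_seq (eq_bigr w).
    by rewrite -big_seq /x subrK.
  by move=> m; rewrite mem_filter => /andP[/negbTE ->].
- move=> m; case: eqP => [->|_].
    by move/eqP: xl; rewrite subr_eq0 => /eqP.
  by rewrite /w cstar_scaleAl zE !scalerA mulrC.
Qed.

(** [x ** a ** star y] equals both [l *: (x ** star y)] and [m *: (x ** star y)]. *)
Lemma eigen_orthogonal a l m x y : star a ** a = a ** star a -> l != m ->
  x ** a = l *: x -> y ** a = m *: y -> x ** star y = 0.
Proof.
move=> na lm xa ya.
have /(rmulB_star na)/eqP : rmulB a m y = 0 by rewrite /rmulB ya subrr.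
rewrite subr_eq0 => /eqP/(congr1 star); rewrite starM starZ starK conjCK => ay.
have /eqP : (l - m) *: (x ** star y) = 0.
  by rewrite scalerBl -cstar_scaleAl -xa -cmulA ay cstar_scaleAr subrr.
by rewrite scaler_eq0 subr_eq0 (negbTE lm) => /eqP.
Qed.

Section WithCoordinates.
Variables (n : nat) (v : F -> 'rV[C]_n) (v' : 'rV[C]_n -> F).
Hypotheses (vlin : linear v) (vK : cancel v v') (v'K : cancel v' v).

Definition rmulmx a : 'M[C]_n := \matrix_i v (v' (delta_mx 0 i) ** a).

Lemma coordD x y : v (x + y) = v x + v y.
Proof. by have := vlin 1 x y; rewrite !scale1r. Qed.

Lemma coord0 : v 0 = 0.
Proof. by apply: (addrI (v 0)); rewrite -coordD !addr0. Qed.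

Lemma coordZ l x : v (l *: x) = l *: v x.
Proof. by have := vlin l x 0; rewrite coord0 !addr0. Qed.

Lemma coord_sum (I : Type) (s : seq I) (f : I -> F) :
  v (\sum_(i <- s) f i) = \sum_(i <- s) v (f i).
Proof. exact: (big_morph v coordD coord0). Qed.

Lemma rmulmxE x a : v x *m rmulmx a = v (x ** a).
Proof.
rewrite mulmx_sum_row.
have {2}-> : x = \sum_i (v x 0 i) *: v' (delta_mx 0 i).
  apply: (can_inj vK); rewrite coord_sum {1}(row_sum_delta (v x)).
  by apply: eq_bigr => i _; rewrite coordZ v'K.
rewrite cmul_suml coord_sum; apply: eq_bigr => i _.
by rewrite rowK cstar_scaleAl coordZ.
Qed.

End WithCoordinates.

(** Cayley-Hamilton for right multiplication by [a], acting on coordinate rows. Dimension 0 is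
    separate because square matrices of size 0 form the zero ring. *)
Lemma eigenvalues_exist (n : nat) (v : F -> 'rV[C]_n) a : linear v -> bijective v ->
  exists s : seq C, forall y, foldl (fun y l => rmulB a l y) y s = 0.
Proof.
case: n v => [|n] v vlin [v' vK v'K].
  by exists [::] => y /=; apply: (can_inj vK); rewrite [LHS]thinmx0 [RHS]thinmx0.
pose A := rmulmx v v' a.
have [s hs] := closed_field_poly_normal (char_poly A).
rewrite (monicP (char_poly_monic A)) scale1r in hs.
exists s => y; apply: (can_inj vK).
have key : v (foldl (fun y l => rmulB a l y) y s) =
    v y *m horner_mx A (\prod_(z <- s) ('X - z%:P)).
  elim: s y {hs} => [|l s IH] y; first by rewrite big_nil rmorph1 mulmx1.
  rewrite big_cons rmorphM /= IH mulmxA; congr (_ *m _).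
  rewrite rmorphB /= horner_mx_X horner_mx_C mulmxBr mul_mx_scalar.
  rewrite rmulmxE // /rmulB -[in RHS]coordZ //.
  by apply/eqP; rewrite eq_sym subr_eq -coordD // subrK.
by rewrite key -hs Cayley_Hamilton mulmx0 coord0.
Qed.

Section UnitElement.
Variables (n : nat) (v : F -> 'rV[C]_n).
Hypotheses (vlin : linear v) (vbij : bijective v).

(** The component [b] of [a] itself at a nonzero eigenvalue [l] satisfies [l b = b a = b ** star b],
    the other components of [a] being orthogonal to [b]. As [l] is real, [b] is self-adjoint and
    [b / l] is a spectral projection, obtained without a unit. *)
Lemma orthogonal_projection a p : star a = a -> a != 0 -> projection p -> a ** p = 0 ->
  exists2 q, projection q & q != 0 /\ q ** p = 0.
Proof.
move=> sa an0 [sp pp] ap.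
have na : star a ** a = a ** star a by rewrite sa.
have [s hs] := eigenvalues_exist a vlin vbij.
have [t [z [ut aE zE]]] := eigen_split na (hs a).
have [l [lt l0 zl0]] : exists l, [/\ l \in t, l != 0 & z l != 0].
  apply: contrapT => h; move/eqP: an0; apply; apply: starM_eq0; rewrite sa.
  rewrite {1}aE cmul_suml big_seq big1 // => l lt.
  rewrite zE; have [->|l0] := eqVneq l 0; first by rewrite scale0r.
  have [->|zl0] := eqVneq (z l) 0; first by rewrite scaler0.
  by case: h; exists l.
set b := z l in zl0.
have bb : b ** star b = l *: b.
  rewrite -(zE l) -/b -[in RHS]sa aE star_sum cmul_sumr.
  rewrite (perm_big _ (perm_to_rem lt)) big_cons rem_filter // big_filter.
  rewrite big1 /= ?addr0 // => m ml.
  by apply: (eigen_orthogonal na _ (zE l) (zE m)); rewrite eq_sym.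
have lR : Num.conj l = l.
  have /eqP : (l - Num.conj l) *: (b ** star b) = 0.
    rewrite scalerBl -cstar_scaleAl -(zE l) -/b.
    have := congr1 star (congr1 (fun x => x ** star b) (zE l)).
    rewrite -/b cstar_scaleAl starZ !starM !starK sa => <-.
    by rewrite cmulA subrr.
  rewrite scaler_eq0 subr_eq0 => /orP[/eqP //|/eqP/Mstar_eq0 b0].
  by rewrite b0 eqxx in zl0.
have sb : star b = b.
  have := congr1 star bb; rewrite starM starK starZ lR bb.
  by move=> /(congr1 (fun x => l^-1 *: x)); rewrite !scalerA mulVf // !scale1r.
exists (l^-1 *: b).
  split; first by rewrite starZ fmorphV /= lR sb.
  rewrite cstar_scaleAl cstar_scaleAr -{2}sb bb !scalerA.
  by rewrite -mulrA mulVf // mulr1.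
split; first by rewrite scaler_eq0 invr_eq0 negb_or l0.
have /eqP : l *: (b ** p) = 0 by rewrite -cstar_scaleAl -zE -cmulA ap cmulr0.
rewrite scaler_eq0 (negbTE l0) /= => /eqP bp.
by rewrite cstar_scaleAl bp scaler0.
Qed.

(** A projection [p] whose right multiplication has maximal rank is a right unit: otherwise some
    [z = y - y p] gives the nonzero [star z ** z], which [p] annihilates, hence a projection [q]
    orthogonal to [p], and [p + q] has larger rank. Taking adjoints makes it two-sided. *)
Theorem unit_exists : exists2 e : F, star e = e & forall x, e ** x = x /\ x ** e = x.
Proof.
have [v' vK v'K] := vbij.
pose M := rmulmx v v'.
have ME x y : v x *m M y = v (x ** y) by rewrite rmulmxE.
have MM x y : M (x ** y) = M x *m M y.
  apply/row_matrixP => i.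
  by rewrite row_mul -[row i (M x)]/(row i (rmulmx v v' x)) !rowK ME cmulA.
have M0 x : M x = 0 -> x = 0.
  move=> x0; apply: starM_eq0; apply: (can_inj vK).
  by rewrite -ME x0 mulmx0 coord0.
pose P k := `[< exists2 p, projection p & \rank (M p) = k >].
have exP : exists k, P k.
  exists (\rank (M 0)); apply/asboolP; exists 0 => //.
  by split; rewrite ?star0 ?cmul0r.
have leP k : P k -> (k <= n)%N by move=> /asboolP[p _ <-]; exact: rank_leq_row.
have [k /asboolP[p [sp pp] rp] kmax] := ex_maxnP exP leP.
have yp y : y ** p = y.
  apply/eqP; rewrite eq_sym -subr_eq0; apply/negPn/negP => zn0.
  set z := y - y ** p in zn0.
  have zp : z ** p = 0 by rewrite cmulBl -cmulA pp subrr.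
  have an0 : star z ** z != 0 by apply: contra_neq zn0 => /starM_eq0.
  have sa : star (star z ** z) = star z ** z by rewrite starM starK.
  have ap : star z ** z ** p = 0 by rewrite -cmulA zp cmulr0.
  have [q [sq qq] [qn0 qp]] := orthogonal_projection sa an0 (conj sp pp) ap.
  have pq : p ** q = 0 by rewrite -sp -sq -starM qp star0.
  have Ppq : P (\rank (M (p + q))).
    apply/asboolP; exists (p + q) => //; split; first by rewrite starD sp sq.
    by rewrite cstar_mulDl !cstar_mulDr pp qq pq qp addr0 add0r.
  have Mle : (M p <= M (p + q)%R)%MS.
    have -> : M p = M p *m M (p + q) by rewrite -MM cstar_mulDr pp pq addr0.
    exact: submxMl.
  (* Equal ranks give equal row spaces, so every [x (p + q)] has the form [y p], and
     [x q = y p q = 0]. *)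
  have /submxP[X hX] : (M (p + q)%R <= M p)%MS.
    by rewrite -(mxrank_leqif_sup Mle) eqn_leq (mxrankS Mle) rp kmax.
  move/eqP: qn0; apply; apply: M0; apply/row_matrixP => i; rewrite row0 rowK.
  set x := v' _; have -> : x ** q = x ** (p + q) ** q.
    by rewrite -cmulA cstar_mulDl pq qq add0r.
  rewrite -!ME hX mulmxA -[v x *m X]v'K ME ME -cmulA pq cmulr0.
  exact: coord0.
exists p => // x; split; last exact: yp.
by rewrite -[x in LHS]starK -{1}sp -starM yp starK.
Qed.

End UnitElement.
End SpectralDecomposition.

(** * Resolutions of a projection and norms of their combinations *)

Section Resolutions.
Context {R : realType} {A : cstarAlgType R}.
Implicit Types (e x : A).

Definition lincomb {I : finType} (c : I -> R[i]) (p : I -> A) : A :=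
  \sum_i c i *: p i.

(** Members may be zero, since [qproj] can send nonzero projections to zero. In [A] the sum [e] is a
    projection that need not be a unit. *)
Definition resolution e {I : finType} (p : I -> A) :=
  [/\ forall i, projection (p i), forall i j, i != j -> p i ** p j = 0 &
      \sum_i p i = e].

Context {I : finType}.
Implicit Types (p : I -> A) (c : I -> R[i]) (r : I -> R).

Lemma lincombZ l c p : l *: lincomb c p = lincomb (fun i => l * c i) p.
Proof. by rewrite scaler_sumr; apply: eq_bigr => i _; rewrite scalerA. Qed.

Lemma lincombD c c' p : lincomb c p + lincomb c' p = lincomb (fun i => c i + c' i) p.
Proof. by rewrite -big_split; apply: eq_bigr => i _; rewrite scalerDl. Qed.

Lemma lincombB c c' p : lincomb c p - lincomb c' p = lincomb (fun i => c i - c' i) p.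
Proof. by rewrite -sumrB; apply: eq_bigr => i _; rewrite scalerBl. Qed.

Lemma eq_lincomb c c' p : c =1 c' -> lincomb c p = lincomb c' p.
Proof. by move=> cc'; apply: eq_bigr => i _; rewrite cc'. Qed.

Section Fixed.
Variables (e : A) (p : I -> A).
Hypothesis rp : resolution e p.

Lemma lincomb1 : lincomb (fun=> 1) p = e.
Proof. by case: rp => _ _ <-; apply: eq_bigr => i _; rewrite scale1r. Qed.

Lemma resolution_mulr c i : lincomb c p ** p i = c i *: p i.
Proof.
case: rp => pp po _; rewrite cmul_suml (bigD1 i) //= big1 ?addr0.
  by rewrite cstar_scaleAl (pp i).2.
by move=> j ji; rewrite cstar_scaleAl po // scaler0.
Qed.

Lemma lincombM c c' : lincomb c p ** lincomb c' p = lincomb (fun i => c i * c' i) p.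
Proof.
rewrite {2}/lincomb cmul_sumr; apply: eq_bigr => i _.
by rewrite cstar_scaleAr resolution_mulr scalerA mulrC.
Qed.

Lemma lincomb_star c : star (lincomb c p) = lincomb (fun i => Num.conj (c i)) p.
Proof.
by case: rp => pp _ _; rewrite star_sum; apply: eq_bigr => i _; rewrite starZ (pp i).1.
Qed.

Lemma resolution_projection : projection e.
Proof.
rewrite -lincomb1; split; last by rewrite lincombM; apply: eq_lincomb => i; rewrite mulr1.
by rewrite lincomb_star; apply: eq_lincomb => i; rewrite rmorph1.
Qed.

(** For [|s| <= 1], the unimodular number with imaginary part [s] and nonnegative real part. It
    replaces [exp (i s)]: it agrees with [1 + i s] up to [s^2] and takes only a square root. *)
Definition circle (s : R) : R[i] := Num.sqrt (1 - s ^+ 2) +i* s.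

Lemma circle_unimodular s : `|s| <= 1 -> Num.conj (circle s) * circle s = 1.
Proof.
move=> s1; rewrite conjCc /circle.
have s2 : 0 <= 1 - s ^+ 2 by rewrite subr_ge0 -real_normK ?num_real // expr_le1.
simpc; rewrite -!expr2 sqr_sqrtr // subrK.
by congr (_ +i* _); ring.
Qed.

Lemma nrm_unimodular c : (forall i, Num.conj (c i) * c i = 1) -> nrm (lincomb c p) <= 1.
Proof.
move=> c1; have h : star (lincomb c p) ** lincomb c p = e.
  by rewrite lincomb_star lincombM -lincomb1; apply: eq_lincomb.
have := nrm_starM (lincomb c p); rewrite h.
have := nrm_projection resolution_projection.
by have := nrm_ge0 (lincomb c p); nra.
Qed.

Lemma nrm_lincomb_real1 r : (forall i, `|r i| <= 1) ->
  nrm (lincomb (fun i => (r i)%:C) p) <= 1.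
Proof.
(* [i * conj (circle s) = s + i sqrt (1 - s^2)] has real part [s]. *)
move=> r1; pose c i := 'i%C * Num.conj (circle (r i)).
have cc i : Num.conj (c i) * c i = 1.
  rewrite rmorphM /= conjCK mulrACA (mulrC (circle _)) circle_unimodular // mulr1.
  by rewrite conjCc; simpc.
have -> : lincomb (fun i => (r i)%:C) p =
    2^-1%:C *: (lincomb c p + star (lincomb c p)).
  rewrite lincomb_star lincombD lincombZ; apply: eq_lincomb => i.
  rewrite /c rmorphM /= conjCK !conjCc /circle; simpc.
  by congr (_ +i* _); field.
have := nrmD (lincomb c p) (star (lincomb c p)); rewrite nrmZr nrm_star.
have := nrm_unimodular cc; rewrite ger0_norm ?invr_ge0 // => ? ?.
by rewrite ler_pdivrMl // mulr1; lra.
Qed.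

Lemma nrm_lincomb_real r m : (forall i, `|r i| <= m) -> 0 <= m ->
  nrm (lincomb (fun i => (r i)%:C) p) <= m.
Proof.
move=> rm; rewrite le_eqVlt => /orP[/eqP m0|m0].
  rewrite /lincomb big1 ?nrm0 -?m0 // => i _.
  have -> : r i = 0 by apply/eqP; rewrite -normr_le0 m0.
  by rewrite scale0r.
have -> : lincomb (fun i => (r i)%:C) p = m%:C *: lincomb (fun i => (r i / m)%:C) p.
  rewrite lincombZ; apply: eq_lincomb => i; rewrite -rmorphM /=; congr (_%:C).
  by rewrite mulrC divfK // gt_eqF.
rewrite nrmZr gtr0_norm // ger_pMr //; apply: nrm_lincomb_real1 => i.
by rewrite normrM normfV (gtr0_norm m0) ler_pdivrMr // mul1r.
Qed.

(** The C*-identity passes from the coefficients [c i] to the real ones [|c i|^2]. *)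
Lemma nrm_lincomb c m : (forall i, complex.Re `|c i| <= m) -> 0 <= m ->
  nrm (lincomb c p) <= m.
Proof.
move=> cm m0.
have h : star (lincomb c p) ** lincomb c p = lincomb (fun i => (complex.Re `|c i| ^+ 2)%:C) p.
  rewrite lincomb_star lincombM; apply: eq_lincomb => i.
  rewrite mulrC -normCK -[X in X ^+ 2 = _](RRe_real (normr_real (c i))).
  by rewrite [RHS]rmorphXn.
have := nrm_starM (lincomb c p); rewrite h.
have : nrm (lincomb (fun i => (complex.Re `|c i| ^+ 2)%:C) p) <= m ^+ 2.
  apply: nrm_lincomb_real => [i|]; last exact: sqr_ge0.
  have c0 : 0 <= complex.Re `|c i| by exact: (nrm_ge0 (c i : R[i]^o)).
  by rewrite ger0_norm ?sqr_ge0 // lerXn2r // nnegrE.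
by have := nrm_ge0 (lincomb c p); nra.
Qed.

End Fixed.
End Resolutions.

Section SpectralTheorem.
Context {R : realType} {F : cstarAlgType R}.
Variable e : F.

Definition unit_element := forall x : F, e ** x = x /\ x ** e = x.
Hypothesis he : unit_element.

Lemma star_unit : star e = e.
Proof. by rewrite -[LHS](he _).2 -{2}(starK e) -starM (he _).2 starK. Qed.

(** The spectral projections are the eigenvector components of the unit: orthogonality gives
    [z l = z l ** star e = z l ** star (z l)]. Zero components are discarded, so that every
    coefficient is bounded by the norm of [a]. *)
Theorem spectral (n : nat) (v : F -> 'rV[R[i]]_n) a : linear v -> bijective v ->
  star a ** a = a ** star a ->
  exists (k : nat) (p : 'I_k -> F) (l : 'I_k -> R[i]),
    [/\ resolution e p, a = lincomb l p & forall i, p i != 0].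
Proof.
move=> vlin vbij na; have [s hs] := eigenvalues_exist a vlin vbij.
have [t [z [ut eE zE]]] := eigen_split na (hs e).
have zo l m : l != m -> z l ** star (z m) = 0.
  by move=> lm; exact: eigen_orthogonal na lm (zE l) (zE m).
have zz l : l \in t -> z l ** star (z l) = z l.
  move=> lt; rewrite -[RHS](he _).2 -star_unit [in RHS]eE star_sum cmul_sumr.
  rewrite (perm_big _ (perm_to_rem lt)) big_cons rem_filter // big_filter.
  by rewrite big1 /= ?addr0 // => m; rewrite eq_sym; exact: zo.
have zs l : l \in t -> star (z l) = z l.
  by move=> lt; rewrite -{1}(zz _ lt) starM starK zz.
pose t' := [seq l <- t | z l != 0].
have tt' i : (i < size t')%N -> t'`_i \in t /\ z t'`_i != 0.
  by move=> /(mem_nth 0); rewrite mem_filter => /andP[].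
have sum_t' (f : R[i] -> F) : (forall l, z l = 0 -> f l = 0) ->
    \sum_(i < size t') f t'`_i = \sum_(l <- t) f l.
  move=> f0; transitivity (\sum_(l <- t') f l); first by rewrite (big_nth 0) big_mkord.
  rewrite big_filter big_mkcond; apply: eq_bigr => l _.
  by case: eqP => //= /f0.
exists (size t'), (fun i => z t'`_i), (fun i => t'`_i); split.
- split.
  + move=> i; have [it _] := tt' _ (ltn_ord i).
    by split; [exact: zs|rewrite -{2}(zs _ it) zz].
  + move=> i j ij; have [jt _] := tt' _ (ltn_ord j).
    rewrite -(zs _ jt); apply: zo; rewrite nth_uniq ?filter_uniq //.
  + by rewrite (sum_t' z) // -eE.
- rewrite /lincomb (sum_t' (fun l => l *: z l)) => [|l ->]; last by rewrite scaler0.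
  rewrite -[LHS](he a).1 {1}eE cmul_suml; apply: eq_bigr => l _; exact: zE.
- by move=> i; have [] := tt' _ (ltn_ord i).
Qed.

End SpectralTheorem.

(** * Rigidity of representations near an almost linear map *)

Section Unitaries.
Context {R : realType} {F : cstarAlgType R}.
Variable e : F.
Hypothesis he : unit_element e.

Definition unitary (u : F) := star u ** u = e /\ u ** star u = e.

Lemma unitary1 : unitary e.
Proof. by rewrite /unitary star_unit //; split; exact: (he e).1. Qed.

Lemma unitary_star u : unitary u -> unitary (star u).
Proof. by move=> [h1 h2]; rewrite /unitary starK. Qed.

Lemma unitaryM u w : unitary u -> unitary w -> unitary (u ** w).
Proof.
move=> [u1 u2] [w1 w2]; rewrite /unitary starM; split.
  by rewrite -cmulA (cmulA (star u)) u1 (he w).1.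
by rewrite -cmulA (cmulA w) w2 (he (star u)).1.
Qed.

Lemma unit_projection : projection e.
Proof. by split; [exact: star_unit|exact: (he e).1]. Qed.

Lemma nrm_unitary u : unitary u -> nrm u <= 1.
Proof.
move=> [h _]; have := nrm_starM u; rewrite h.
by have := nrm_projection unit_projection; have := nrm_ge0 u; nra.
Qed.

Lemma unitary_lincomb {I : finType} (p : I -> F) c : resolution e p ->
  (forall i, Num.conj (c i) * c i = 1) -> unitary (lincomb c p).
Proof.
move=> rp c1; rewrite /unitary (lincomb_star rp) !(lincombM rp) -(lincomb1 rp).
by split; apply: eq_lincomb => i //; rewrite mulrC.
Qed.

End Unitaries.

Section Rigidity.
Context {R : realType} {A : cstarAlgType R}.
Variable E : A.
Hypothesis pE : projection E.

(* If [z = w - E] then [w ** w - E = z + z + z ** z], so small distances to [E]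
   grow by a factor [3 / 2] under squaring. *)
Lemma near_unit_trivial (w : nat -> A) :
  (forall k, E ** w k = w k /\ w k ** E = w k) ->
  (forall k, w k ** w k = w k.+1) -> (forall k, nrm (w k - E) <= 1/2) -> w 0%N = E.
Proof.
move=> Ew ww wE; apply/eqP; rewrite -subr_eq0; apply/eqP; apply: nrm_small => eta eta0.
have grow k : nrm (w k - E) <= 2/3 * nrm (w k.+1 - E).
  set z := w k - E.
  have h : z + z = (w k.+1 - E) - z ** z.
    by rewrite /z -ww cmulBl !cmulBr (Ew k).1 (Ew k).2 pE.2; nc_ring.
  have h2 : nrm (z + z) = 2 * nrm z.
    by have := nrm_halve (z + z); rewrite halveD halve_double; lra.
  have := cnrmB (w k.+1 - E) (z ** z); rewrite -h h2.
  by have := wE k; have := nrmM z z; rewrite -/z; have := nrm_ge0 z; nra.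
have pow k : nrm (w 0%N - E) <= (2/3) ^+ k * nrm (w k - E).
  elim: k => [|k IH]; first by rewrite mul1r.
  apply: le_trans IH _; rewrite exprSr -mulrA ler_wpM2l // exprn_ge0 //; lra.
have h23 : 0 <= (2/3 : R) < 1 by apply/andP; split; lra.
have [j hj] := expr_small 1 h23 eta0.
apply: le_trans (pow j) _; rewrite mul1r in hj.
have := wE j; have : 0 <= (2/3 : R) ^+ j by rewrite exprn_ge0 //; lra.
by have := nrm_ge0 (w j - E); nra.
Qed.

End Rigidity.

Section Rotations.
Context {R : realType} {A : cstarAlgType R}.
Implicit Types (f p : A) (l m : R[i]).

(** In the corner of [f], for [p] under [f] and unimodular [l], the unitary that is [l] on [p] and
    [1] on [f - p]. *)
Definition rot f p l : A := f + (l - 1) *: p.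

Definition subprojection f p := [/\ projection f, projection p, f ** p = p & p ** f = p].

Lemma rot1 f p : rot f p 1 = f.
Proof. by rewrite /rot subrr scale0r addr0. Qed.

Lemma rotM f p l m : subprojection f p -> rot f p l ** rot f p m = rot f p (l * m).
Proof.
move=> [[_ ff] [_ pp] fp pf]; rewrite /rot cstar_mulDl !cstar_mulDr.
rewrite !(cstar_scaleAl, cstar_scaleAr) fp pf ff pp scalerA -!addrA; congr (_ + _).
by rewrite -!scalerDl; congr (_ *: _); ring.
Qed.

Lemma rot_star f p l : subprojection f p -> star (rot f p l) = rot f p (Num.conj l).
Proof.
by move=> [[sf _] [sp _] _ _]; rewrite /rot starD starZ sf sp rmorphB rmorph1.
Qed.

Lemma rot_absorb f p l : subprojection f p ->
  f ** rot f p l = rot f p l /\ rot f p l ** f = rot f p l.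
Proof.
move=> [[_ ff] _ fp pf].
by rewrite /rot cstar_mulDl cstar_mulDr cstar_scaleAl cstar_scaleAr fp pf ff.
Qed.

Lemma norm_unimodular l : Num.conj l * l = 1 -> `|l| = 1.
Proof.
move=> h; have : `|l| ^+ 2 = 1 by rewrite normCK mulrC.
by move/eqP; rewrite sqrf_eq1 => /orP[/eqP //|/eqP h1]; have := normr_ge0 l;
  rewrite h1 lerNr oppr0 ler10.
Qed.

Lemma nrm_unimodular_sub1 l (x : A) a : Num.conj l * l = 1 -> nrm x <= a ->
  nrm ((l - 1) *: x) <= 2 * a.
Proof.
move=> /norm_unimodular l1 xa; rewrite scalerBl scale1r.
apply: le_trans (cnrmB _ _) _; rewrite nrmZ l1 mul1r; lra.
Qed.

End Rotations.

Section AlmostLinear.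
Context {R : realType} {F A : cstarAlgType R}.
Variables (phi : F -> A) (delta : R).
Hypothesis hphi : delta_star_homomorphism delta phi.
Implicit Types (x y : F).

Lemma approxD x y : nrm x <= 1 -> nrm y <= 1 ->
  nrm (phi (x + y) - phi x - phi y) <= delta.
Proof.
rewrite -!nrm_le1 => hx hy; have l0 : `|0 : R[i]| <= 1 by rewrite normr0.
by rewrite -nrm_le; have [] := hphi hx hy l0.
Qed.

Lemma approxZ x (l : R[i]) : nrm x <= 1 -> `|l| <= 1 ->
  nrm (phi (l *: x) - l *: phi x) <= delta.
Proof. by rewrite -!nrm_le1 => hx l1; rewrite -nrm_le; have [] := hphi hx hx l1. Qed.

Lemma approxM x y : nrm x <= 1 -> nrm y <= 1 ->
  nrm (phi (x ** y) - phi x ** phi y) <= delta.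
Proof.
rewrite -!nrm_le1 => hx hy; have l0 : `|0 : R[i]| <= 1 by rewrite normr0.
by rewrite -nrm_le; have [] := hphi hx hy l0.
Qed.

Lemma approx_star x : nrm x <= 1 -> nrm (phi (star x) - star (phi x)) <= delta.
Proof.
rewrite -!nrm_le1 => hx; have l0 : `|0 : R[i]| <= 1 by rewrite normr0.
by rewrite -nrm_le; have [] := hphi hx hx l0.
Qed.

Lemma approx_nrm x : nrm x <= 1 -> nrm (phi x) <= 1 + delta.
Proof.
rewrite -!nrm_le1 => hx; have l0 : `|0 : R[i]| <= 1 by rewrite normr0.
by rewrite -nrm_le rmorphD /=; have [] := hphi hx hx l0.
Qed.

Lemma approx0 : nrm (phi 0) <= delta.
Proof.
have := @approxZ 0 0; rewrite nrm0 normr0 !scale0r subr0; apply; exact: ler01.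
Qed.

Lemma approxN x : nrm x <= 1 -> nrm (phi (- x) + phi x) <= delta.
Proof.
move=> hx; have := @approxZ x (-1) hx; rewrite normrN1 lexx !scaleN1r opprK.
by apply.
Qed.

Lemma approxB x y : nrm x <= 1 -> nrm y <= 1 ->
  nrm (phi (x - y) - phi x + phi y) <= 2 * delta.
Proof.
move=> hx hy; have hNy : nrm (- y) <= 1 by rewrite nrmN.
have -> : phi (x - y) - phi x + phi y =
  (phi (x - y) - phi x - phi (- y)) + (phi (- y) + phi y) by nc_ring.
by have := cnrmD (phi (x - y) - phi x - phi (- y)) (phi (- y) + phi y);
  have := approxD hx hNy; have := approxN hy; lra.
Qed.

End AlmostLinear.

Section NearbyRepresentation.
Context {R : realType} {F A : cstarAlgType R}.
Variables (e : F) (E : A) (phi : F -> A) (r : F -> A) (delta kappa : R).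
Hypotheses (he : unit_element e) (pE : projection E).
Hypothesis hphi : delta_star_homomorphism delta phi.
Hypotheses (dk : delta <= kappa) (k1 : kappa <= 1/100).
Hypothesis rM : forall u w, unitary e u -> unitary e w -> r (u ** w) = r u ** r w.
Hypothesis rV : forall u, unitary e u -> r (star u) = star (r u).
Hypothesis r1 : r e = E.
Hypothesis rphi : forall u, unitary e u -> nrm (r u - phi u) <= kappa.

Implicit Types (p q : F) (l : R[i]).

Let ue := unitary1 he.

Lemma r_absorb u : unitary e u -> E ** r u = r u /\ r u ** E = r u.
Proof. by move=> uu; rewrite -r1 -!rM // (he u).1 (he u).2. Qed.

Definition symmetry p : F := e - p - p.

Definition qproj p : A := halve (E - r (symmetry p)).

Lemma unit_proj p : projection p -> [/\ e ** p = p, p ** e = p & e ** e = e].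
Proof. by rewrite (he p).1 (he p).2 (he e).1. Qed.

Lemma proj_compl p : projection p -> projection (e - p).
Proof.
move=> pp; have [ep pe ee] := unit_proj pp; split.
  by rewrite starB star_unit // pp.1.
by rewrite cmulBl !cmulBr ep pe ee pp.2; nc_ring.
Qed.

Lemma unitary_symmetry p : projection p -> unitary e (symmetry p).
Proof.
move=> pp; have [ep pe ee] := unit_proj pp.
have ss : star (symmetry p) = symmetry p by rewrite !starB star_unit // pp.1.
suff h : symmetry p ** symmetry p = e by rewrite /unitary ss h.
by rewrite !(cmulBl, cmulBr) ep pe ee pp.2; nc_ring.
Qed.

Lemma symmetry_sq p : projection p -> symmetry p ** symmetry p = e.
Proof.
move=> pp; have [h _] := unitary_symmetry pp; rewrite -[RHS]h.
by rewrite !starB star_unit // pp.1.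
Qed.

Lemma halveM (x y : A) : halve x ** halve y = halve (halve (x ** y)).
Proof. by rewrite /halve cstar_scaleAl cstar_scaleAr. Qed.

Lemma qproj_projection p : projection p -> projection (qproj p).
Proof.
move=> pp; have us := unitary_symmetry pp; have [Er rE] := r_absorb us.
have rr : r (symmetry p) ** r (symmetry p) = E by rewrite -rM // symmetry_sq.
split.
  rewrite /qproj /halve starZr starB pE.1 -rV //.
  by rewrite !starB star_unit // pp.1.
rewrite /qproj halveM cmulBl !cmulBr pE.2 Er rE rr.
congr halve; set x := r _.
have -> : E - x - (x - E) = (E - x) + (E - x) by nc_ring.
by rewrite halveD halve_double.
Qed.

Lemma qproj_near p : projection p -> nrm (qproj p - phi p) <= 3 * kappa.
Proof.
move=> pp; have us := unitary_symmetry pp.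
have p1 := nrm_projection pp; have ep1 := nrm_projection (proj_compl pp).
have e1 := nrm_projection (unit_projection he).
rewrite -[phi p]halve_double -halveD -halveB nrm_halve.
(* The symmetry is taken as [(e - p) - p]: additivity of [phi] is known on the unit ball only, which
   may not contain [p + p]. *)
have -> : E - r (symmetry p) - (phi p + phi p) =
    (r e - phi e) - (r (symmetry p) - phi (symmetry p))
    - (phi (symmetry p) - phi (e - p) + phi p) - (phi (e - p) - phi e + phi p).
  by rewrite r1; nc_ring.
set x1 := r e - _; set x2 := r _ - _; set x3 := phi (symmetry p) - _ + _; set x4 := _ + phi p.
have h1 : nrm x1 <= kappa := rphi ue.
have h2 : nrm x2 <= kappa := rphi us.
have h3 : nrm x3 <= 2 * delta := approxB hphi ep1 p1.
have h4 : nrm x4 <= 2 * delta := approxB hphi e1 p1.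
have := cnrmB (x1 - x2 - x3) x4; have := cnrmB (x1 - x2) x3; have := cnrmB x1 x2.
by have := dk; lra.
Qed.

Lemma qproj_comm u p : projection p -> unitary e u -> u ** p = p ** u ->
  r u ** qproj p = qproj p ** r u.
Proof.
move=> pp uu up; have us := unitary_symmetry pp; have [Er rE] := r_absorb uu.
rewrite /qproj /halve cstar_scaleAr cstar_scaleAl cmulBl cmulBr Er rE -!rM //.
by rewrite /symmetry !cmulBl !cmulBr up (he u).1 (he u).2.
Qed.

Lemma qproj_absorb p : projection p -> E ** qproj p = qproj p /\ qproj p ** E = qproj p.
Proof.
move=> pp; have [Er rE] := r_absorb (unitary_symmetry pp).
by rewrite /qproj /halve cstar_scaleAr cstar_scaleAl cmulBl cmulBr pE.2 Er rE.
Qed.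

(** The two commute, so their product is idempotent; it is near [phi p ** phi p'], hence near
    [phi 0], so its norm is below 1. *)
Lemma qproj_orthogonal p p' : projection p -> projection p' -> p ** p' = 0 ->
  p' ** p = 0 -> qproj p ** qproj p' = 0.
Proof.
move=> pp pp' o1 o2.
have q1 := nrm_projection (qproj_projection pp').
have qq : qproj p ** qproj p' = qproj p' ** qproj p.
  have [Eq qE] := qproj_absorb pp'.
  have comm : r (symmetry p) ** qproj p' = qproj p' ** r (symmetry p).
    apply: qproj_comm => //; first exact: unitary_symmetry.
    by rewrite /symmetry !cmulBl !cmulBr (he p').1 (he p').2 o1 o2.
  move: (qproj p') Eq qE comm => q' Eq qE comm.
  by rewrite /qproj /halve cstar_scaleAl cstar_scaleAr cmulBl cmulBr Eq qE comm.
apply: idempotent_small.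
  rewrite -cmulA (cmulA (qproj p')) -qq -cmulA (qproj_projection pp').2.
  by rewrite cmulA (qproj_projection pp).2.
have p1 := nrm_projection pp; have p1' := nrm_projection pp'.
have h1 := nrmM_sub (qproj p) (qproj p') (phi p) (phi p').
have h2 := approxM hphi p1 p1'; rewrite o1 in h2.
have h3 := approx0 hphi; have h4 := approx_nrm hphi p1.
have h5 := qproj_near pp; have h6 := qproj_near pp'.
have h7 := ler_pM (nrm_ge0 _) (nrm_ge0 _) h5 q1.
have h8 := ler_pM (nrm_ge0 _) (nrm_ge0 _) h4 h6.
have h9 := cnrm_subl (phi p ** phi p') (phi 0); rewrite cnrmC in h2.
have h10 := cnrm_subl (qproj p ** qproj p') (phi p ** phi p').
have := nrm_ge0 (phi 0); have := dk; have := k1.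
by nra.
Qed.

Lemma sub_unit p : projection p -> subprojection e p.
Proof. by move=> pp; have [] := unit_proj pp; split => //; exact: unit_projection. Qed.

Lemma sub_qproj p : projection p -> subprojection E (qproj p).
Proof. by move=> pp; have [] := qproj_absorb pp; split => //; exact: qproj_projection. Qed.

Lemma rot_unitary p l : projection p -> Num.conj l * l = 1 -> unitary e (rot e p l).
Proof.
move=> /sub_unit sp l1.
by rewrite /unitary rot_star // !rotM // (mulrC l) l1 rot1.
Qed.

Lemma r_rot_near p l : projection p -> Num.conj l * l = 1 ->
  nrm (r (rot e p l) - rot E (qproj p) l) <= 12 * kappa.
Proof.
move=> pp l1; have uu := rot_unitary pp l1; have ln := norm_unimodular l1.
have p1 := nrm_projection pp; have ep1 := nrm_projection (proj_compl pp).
have e1 := nrm_projection (unit_projection he).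
have lp1 : nrm (l *: p) <= 1 by rewrite nrmZ ln mul1r.
have l1' : `|l| <= 1 by rewrite ln.
have uE : rot e p l = (e - p) + l *: p by rewrite /rot scalerBl scale1r; nc_ring.
have h1 := rphi uu; have h2 := approxD hphi ep1 lp1; have h3 := approxZ hphi p1 l1'.
have h4 := approxB hphi e1 p1; have h5 := rphi ue.
have h6 := nrm_unimodular_sub1 l1 (qproj_near pp).
have -> : r (rot e p l) - rot E (qproj p) l =
  (r (rot e p l) - phi (rot e p l)) + (phi (e - p + l *: p) - phi (e - p) - phi (l *: p))
  + (phi (l *: p) - l *: phi p) + (phi (e - p) - phi e + phi p)
  - (r e - phi e) - (l - 1) *: (qproj p - phi p).
  rewrite -uE r1 [rot E _ _]/rot.
  have -> : (l - 1) *: (qproj p - phi p) = (l - 1) *: qproj p - (l *: phi p - phi p).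
    by rewrite scalerBr [(l - 1) *: phi p]scalerBl scale1r.
  by nc_ring.
rewrite -uE in h2 *.
set x1 := r (rot e p l) - _ in h1 *; set x2 := phi (rot e p l) - _ - _ in h2 *.
set x3 := phi (l *: p) - _ in h3 *; set x4 := phi (e - p) - _ + _ in h4 *.
set x5 := r e - _ in h5 *; set x6 := _ *: _ in h6 *.
have := cnrmB (x1 + x2 + x3 + x4 - x5) x6; have := cnrmB (x1 + x2 + x3 + x4) x5.
have := cnrmD (x1 + x2 + x3) x4; have := cnrmD (x1 + x2) x3; have := cnrmD x1 x2.
by have := dk; lra.
Qed.

(** The quotient [w k] of the two sides at [l^(2^k)] stays within [36 kappa <= 1/2] of [E], and
    [w k ** w k = w k.+1] because [r] of a rotation about [p] commutes with [qproj p]. So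
    [near_unit_trivial] applies. *)
Lemma r_rot p l : projection p -> Num.conj l * l = 1 ->
  r (rot e p l) = rot E (qproj p) l.
Proof.
move=> pp l1; have sp := sub_unit pp; have sq := sub_qproj pp.
have cl1 (m : R[i]) : Num.conj m * m = 1 -> Num.conj (Num.conj m) * Num.conj m = 1.
  by rewrite conjCK mulrC.
have pow1 k : Num.conj (l ^+ (2 ^ k)) * l ^+ (2 ^ k) = 1.
  by rewrite rmorphXn -exprMn l1 expr1n.
pose m k := l ^+ (2 ^ k).
have um k : unitary e (rot e p (m k)) by exact: rot_unitary (pow1 k).
have mS k : m k * m k = m k.+1 by rewrite /m -expr2 -exprM expnSr.
have TT k : rot E (qproj p) (m k) ** rot E (qproj p) (Num.conj (m k)) = E.
  by rewrite rotM // mulrC pow1 rot1.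
pose w k : A := r (rot e p (m k)) ** rot E (qproj p) (Num.conj (m k)).
have comm k k' : r (rot e p (m k)) ** rot E (qproj p) (Num.conj (m k')) =
    rot E (qproj p) (Num.conj (m k')) ** r (rot e p (m k)).
  have uk := rot_unitary pp (pow1 k).
  rewrite {2 3}/rot cstar_mulDl cstar_mulDr (cstar_scaleAl _ (qproj p)) (cstar_scaleAr _ _ (qproj p)).
  rewrite (r_absorb uk).1 (r_absorb uk).2 qproj_comm //.
  by rewrite /rot cstar_mulDl cstar_mulDr cstar_scaleAl cstar_scaleAr (he p).1 (he p).2.
have w0 : w 0%N = E.
  apply: (near_unit_trivial pE) => k.
  - rewrite /w cmulA (r_absorb (rot_unitary pp (pow1 k))).1.
    by rewrite -cmulA (rot_absorb _ sq).2.
  - rewrite /w -[LHS]cmulA (cmulA (rot E _ _)) -comm !cmulA -rM ?rotM //.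
    by rewrite -cmulA rotM // -rmorphM !mS.
  - have -> : w k - E = (r (rot e p (m k)) - rot E (qproj p) (m k)) **
        rot E (qproj p) (Num.conj (m k)) by rewrite cmulBl TT.
    have T3 : nrm (rot E (qproj p) (Num.conj (m k))) <= 3.
      apply: le_trans (cnrmD _ _) _.
      have := nrm_unimodular_sub1 (cl1 _ (pow1 k)) (nrm_projection (qproj_projection pp)).
      by have := nrm_projection pE; lra.
    have := nrmM_le (r_rot_near pp (pow1 k)) T3.
    by have := k1; lra.
have := congr1 (fun x => x ** rot E (qproj p) (m 0%N)) w0.
rewrite /w -cmulA rotM // pow1 rot1 (rot_absorb _ sq).1 /m expr1.
by rewrite (r_absorb (rot_unitary pp l1)).2.
Qed.

(** [E - qproj e] is an idempotent of norm at most [4 kappa]. *)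
Lemma qproj_unit : qproj e = E.
Proof.
have pe := unit_projection he; have [Eq qE] := qproj_absorb pe.
apply/eqP; rewrite eq_sym -subr_eq0; apply/eqP; apply: idempotent_small.
  by rewrite cmulBl !cmulBr Eq qE pE.2 (qproj_projection pe).2; nc_ring.
have := cnrm_sub (phi e) E (qproj e); rewrite (cnrmC (phi e)).
have := qproj_near pe; have := rphi ue; rewrite r1; have := k1.
by lra.
Qed.

Section Resolution.
Variables (I : finType) (p : I -> F).
Hypothesis rp : resolution e p.

Lemma r_rot_seq (s : seq I) (c : I -> R[i]) : uniq s ->
  (forall i, Num.conj (c i) * c i = 1) ->
  unitary e (e + \sum_(i <- s) (c i - 1) *: p i) /\
  r (e + \sum_(i <- s) (c i - 1) *: p i) = E + \sum_(i <- s) (c i - 1) *: qproj (p i).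
Proof.
move=> us c1; have [pp po _] := rp.
elim: s us => [|i s IH] /=; first by rewrite !big_nil !addr0.
move=> /andP[iNs /IH[uS rS]].
(* Stated for an arbitrary algebra, to be applied in [F] to the [p i] and in [A] to the
   [qproj (p i)]. *)
have prod (B : cstarAlgType R) (f : B) (q : I -> B) : f ** f = f ->
    (forall j, f ** q j = q j /\ q j ** f = q j) -> (forall j, i != j -> q i ** q j = 0) ->
    rot f (q i) (c i) ** (f + \sum_(j <- s) (c j - 1) *: q j) =
    f + \sum_(j <- i :: s) (c j - 1) *: q j.
  move=> ff fq qo; rewrite big_cons /rot cstar_mulDl !cstar_mulDr.
  rewrite (cstar_scaleAl _ (q i) f) (fq i).2 ff.
  have -> : f ** (\sum_(j <- s) (c j - 1) *: q j) = \sum_(j <- s) (c j - 1) *: q j.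
    by rewrite cmul_sumr; apply: eq_bigr => j _; rewrite cstar_scaleAr (fq j).1.
  have -> : ((c i - 1) *: q i) ** (\sum_(j <- s) (c j - 1) *: q j) = 0.
    rewrite cmul_sumr big_seq big1 // => j js.
    rewrite cstar_scaleAl cstar_scaleAr qo ?scaler0 //.
    by apply: contraNneq iNs => ->.
  by nc_ring.
have eE : e + \sum_(j <- i :: s) (c j - 1) *: p j =
    rot e (p i) (c i) ** (e + \sum_(j <- s) (c j - 1) *: p j).
  rewrite prod //; first exact: (he e).1.
  by move=> j ij; exact: po.
have ui := rot_unitary (pp i) (c1 i).
split; first by rewrite eE; exact: unitaryM.
rewrite eE rM // rS r_rot //; apply: prod; first exact: pE.2.
  by move=> j; exact: qproj_absorb.
by move=> j ij; apply: qproj_orthogonal => //; apply: po => //; rewrite eq_sym.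
Qed.

Lemma lincomb_rot (B : cstarAlgType R) (f : B) (q : I -> B) c : \sum_i q i = f ->
  lincomb c q = f + \sum_i (c i - 1) *: q i.
Proof.
move=> <-; rewrite -big_split; apply: eq_bigr => i _ /=.
by rewrite scalerBl scale1r addrC subrK.
Qed.

Lemma qproj_resolution : resolution E (fun i => qproj (p i)).
Proof.
have [pp po pe] := rp; split.
- by move=> i; exact: qproj_projection.
- by move=> i j ij; apply: qproj_orthogonal => //; apply: po => //; rewrite eq_sym.
(* With all coefficients [-1] the product of rotations is [symmetry e], which [r] sends to [- E] by
   [qproj_unit]; this determines the sum. *)
have N1 : Num.conj (-1) * -1 = 1 :> R[i] by rewrite rmorphN1 mulrNN mulr1.
have [_] := @r_rot_seq (index_enum I) (fun=> -1) (index_enum_uniq I) (fun=> N1).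
have scale (B : cstarAlgType R) (q : I -> B) :
    \sum_(i <- index_enum I) (-1 - 1) *: q i = - (\sum_i q i) - \sum_i q i.
  by rewrite -scaler_sumr scalerBl scaleN1r scale1r.
rewrite !scale pe.
have -> : e + (- e - e) = symmetry e by rewrite /symmetry; nc_ring.
have -> : r (symmetry e) = - E.
  have := qproj_unit; rewrite /qproj => /(congr1 (fun x => x + x)); rewrite halve_double.
  by move=> h; rewrite -[LHS](subKr E) h; nc_ring.
set S := \sum_i _ => h; rewrite -[S]halve_double -[E]halve_double -!halveD; congr halve.
apply/eqP; rewrite -subr_eq0.
have -> : S + S - (E + E) = - (E + (- S - S) - (- E)) by nc_ring.
by rewrite -h subrr oppr0.
Qed.

Lemma r_lincomb (c : I -> R[i]) : (forall i, Num.conj (c i) * c i = 1) ->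
  r (lincomb c p) = lincomb c (fun i => qproj (p i)).
Proof.
move=> c1; have [_ _ pe] := rp; have [_ _ qE] := qproj_resolution.
rewrite (lincomb_rot c pe) (lincomb_rot c qE).
by have [_ ->] := r_rot_seq (index_enum_uniq I) c1.
Qed.

End Resolution.
End NearbyRepresentation.

(** * Linear extension *)

Section RealCombinations.
Context {R : realType} {A : cstarAlgType R} {I : finType}.
Implicit Types (a b : I -> R) (p : I -> A).

Definition rlincomb a p : A := lincomb (fun i => (a i)%:C) p.

Lemma rlincombZ t a p : t%:C *: rlincomb a p = rlincomb (fun i => t * a i) p.
Proof. by rewrite /rlincomb lincombZ; apply: eq_lincomb => i; rewrite rmorphM. Qed.

(** The remainder has real coefficients: [sqrt (1 - s^2) - 1] lies between [- s^2] and [0]. *)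
Lemma circle_expand (f : A) p a (t m : R) : resolution f p -> (forall i, `|a i| <= m) ->
  0 <= t -> t * m <= 1 ->
  nrm (lincomb (fun i => circle (t * a i)) p - f - (0 +i* t) *: rlincomb a p) <= (t * m) ^+ 2.
Proof.
move=> rp am t0 tm.
rewrite -(lincomb1 rp) /rlincomb lincombZ !lincombB.
have -> : lincomb (fun i => circle (t * a i) - 1 - (0 +i* t) * (a i)%:C) p =
    lincomb (fun i => (Num.sqrt (1 - (t * a i) ^+ 2) - 1)%:C) p.
    by apply: eq_lincomb => i; rewrite /circle; simpc.
apply: (nrm_lincomb_real rp); last exact: sqr_ge0.
move=> i; set s := t * a i.
have s1 : `|s| <= t * m by rewrite /s normrM ger0_norm // ler_wpM2l.
have tm0 : 0 <= t * m := le_trans (normr_ge0 _) s1.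
have s2 : s ^+ 2 <= (t * m) ^+ 2.
  by rewrite -(real_normK (num_real s)) lerXn2r ?nnegrE.
have s3 : s ^+ 2 <= 1.
  by apply: le_trans s2 _; rewrite expr_le1.
have y0 : 0 <= Num.sqrt (1 - s ^+ 2) by exact: sqrtr_ge0.
have : Num.sqrt (1 - s ^+ 2) ^+ 2 = 1 - s ^+ 2 by rewrite sqr_sqrtr // subr_ge0.
move: (Num.sqrt _) y0 => y y0 yy; apply: le_trans _ s2.
have s0 := sqr_ge0 s.
by rewrite ler_norml; apply/andP; split; nra.
Qed.

End RealCombinations.

Lemma nrm_imaginary {R : realType} {A : cstarAlgType R} (t : R) (x : A) : 0 <= t ->
  nrm ((0 +i* t) *: x) = t * nrm x.
Proof.
by move=> t0; rewrite nrmZ normc_def /= expr0n add0r sqrtr_sqr ger0_norm.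
Qed.

Section LinearExtension.
Context {R : realType} {F A : cstarAlgType R}.
Variables (e : F) (E : A) (r : F -> A) (q : F -> A).
Hypotheses (he : unit_element e) (pE : projection E).
Hypothesis rM : forall u w, unitary e u -> unitary e w -> r (u ** w) = r u ** r w.
Hypothesis rV : forall u, unitary e u -> r (star u) = star (r u).
Hypothesis r1 : r e = E.
Hypothesis rq : forall k (p : 'I_k -> F), resolution e p ->
  resolution E (fun i => q (p i)) /\
  forall c, (forall i, Num.conj (c i) * c i = 1) ->
    r (lincomb c p) = lincomb c (fun i => q (p i)).
Hypothesis hspec : forall a : F, star a ** a = a ** star a ->
  exists (k : nat) (p : 'I_k -> F) (l : 'I_k -> R[i]),
    [/\ resolution e p, a = lincomb l p & forall i, p i != 0].

Lemma coef_le_nrm k (p : 'I_k -> F) l i : resolution e p -> p i != 0 ->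
  complex.Re `|l i| <= nrm (lincomb l p).
Proof.
move=> rp pn0; have p0 : 0 < nrm (p i).
  by rewrite lt_def nrm_ge0 andbT; apply: contra_neq pn0 => /nrm0_eq0.
have := nrmM (lincomb l p) (p i); rewrite (resolution_mulr rp) nrmZ.
by rewrite ler_pM2r.
Qed.

Lemma unitary_coef k (p : 'I_k -> F) l i : resolution e p -> p i != 0 ->
  unitary e (lincomb l p) -> Num.conj (l i) * l i = 1.
Proof.
move=> rp pn0 [h _]; rewrite (lincomb_star rp) (lincombM rp) in h.
have := resolution_mulr rp (fun i => Num.conj (l i) * l i) i; rewrite h (he _).1.
rewrite -{1}[p i]scale1r => /eqP; rewrite -subr_eq0 -scalerBl scaler_eq0 (negbTE pn0) orbF.
by rewrite subr_eq0 => /eqP.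
Qed.

(** [r] keeps the eigenvalues of [u] and replaces its eigenprojections by others, some of which may
    vanish, so the largest [|l i - 1|] cannot grow. *)
Lemma r_contraction u : unitary e u -> nrm (r u - E) <= nrm (u - e).
Proof.
move=> uu; have [|k [p [l [rp uE pn0]]]] := hspec (a := u); first by rewrite uu.1 uu.2.
have [rqp rl] := rq rp; rewrite uE in uu *.
have l1 i := unitary_coef rp (pn0 i) uu.
rewrite rl // -(lincomb1 rqp) -(lincomb1 rp) !lincombB.
by apply: (nrm_lincomb rqp) => [i|]; [exact: coef_le_nrm|exact: nrm_ge0].
Qed.

Lemma q_additive k1 k2 k3 (p1 : 'I_k1 -> F) (p2 : 'I_k2 -> F) (p3 : 'I_k3 -> F) a b c :
  resolution e p1 -> resolution e p2 -> resolution e p3 ->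
  rlincomb a p1 + rlincomb b p2 = rlincomb c p3 ->
  rlincomb a (fun i => q (p1 i)) + rlincomb b (fun i => q (p2 i)) =
    rlincomb c (fun i => q (p3 i)).
Proof.
move=> rp1 rp2 rp3 X0.
set Ya := rlincomb a _; set Yb := rlincomb b _; set Yc := rlincomb c _.
pose m := 1 + \sum_i `|a i| + \sum_i `|b i| + \sum_i `|c i|.
have sum0 k (x : 'I_k -> R) : 0 <= \sum_i `|x i| by apply: sumr_ge0.
have sumi k (x : 'I_k -> R) i : `|x i| <= \sum_i `|x i|.
  by rewrite (bigD1 i) //= lerDl; apply: sumr_ge0.
have sa := sum0 _ a; have sb := sum0 _ b; have sc := sum0 _ c.
have am i : `|a i| <= m by have := sumi _ a i; rewrite /m; lra.
have bm i : `|b i| <= m by have := sumi _ b i; rewrite /m; lra.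
have cm i : `|c i| <= m by have := sumi _ c i; rewrite /m; lra.
have m1 : 1 <= m by rewrite /m; lra.
(* Errors [(7 + 4 + 3) s^2] of second order in [t], divided by [t]. *)
have bound t : 0 < t -> t * m <= 1 -> nrm (Ya + Yb - Yc) <= 14 * (t * m ^+ 2).
  move=> t0 tm; have t0' := ltW t0; pose s := t * m; pose tau : R[i] := 0 +i* t.
  have s0 : 0 <= s by rewrite mulr_ge0 // (le_trans ler01).
  (* For [F] and [A] alike: up to second order, [U + V - W] is [i t] times the combination that is
     to vanish. *)
  have tri (B : cstarAlgType R) (f : B) (P1 : 'I_k1 -> B) (P2 : 'I_k2 -> B) (P3 : 'I_k3 -> B)
      (U V W : B) : resolution f P1 -> resolution f P2 -> resolution f P3 ->
      U = lincomb (fun i => circle (t * a i)) P1 - f ->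
      V = lincomb (fun i => circle (t * b i)) P2 - f ->
      W = lincomb (fun i => circle (t * c i)) P3 - f ->
      nrm (U ** V) <= 4 * s ^+ 2 /\
      nrm (U + V - W - tau *: (rlincomb a P1 + rlincomb b P2 - rlincomb c P3)) <= 3 * s ^+ 2.
    move=> h1 h2 h3 UE VE WE.
    have := circle_expand h1 am t0' tm; have := circle_expand h2 bm t0' tm.
    have := circle_expand h3 cm t0' tm; rewrite -UE -VE -WE -/tau -/s.
    set Xa := rlincomb a P1; set Xb := rlincomb b P2; set Xc := rlincomb c P3.
    set w := W - _; set v := V - _; set u := U - _ => wb vb ub.
    have t1 : nrm (tau *: Xa) <= s.
      by rewrite nrm_imaginary // ler_wpM2l //; apply: (nrm_lincomb_real h1); rewrite ?(le_trans ler01).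
    have t2 : nrm (tau *: Xb) <= s.
      by rewrite nrm_imaginary // ler_wpM2l //; apply: (nrm_lincomb_real h2); rewrite ?(le_trans ler01).
    have ss : s ^+ 2 <= s by rewrite expr2 ler_piMr.
    have U2 : nrm U <= 2 * s.
      by rewrite -[U](subrK (tau *: Xa)) -/u; have := cnrmD u (tau *: Xa); lra.
    have V2 : nrm V <= 2 * s.
      by rewrite -[V](subrK (tau *: Xb)) -/v; have := cnrmD v (tau *: Xb); lra.
    split; first by have := nrmM_le U2 V2; lra.
    have -> : U + V - W - tau *: (Xa + Xb - Xc) = u + v - w.
      by rewrite scalerBr scalerDr /u /v /w; nc_ring.
    by have := cnrmB (u + v) w; have := cnrmD u v; lra.
  have circ x : `|x| <= m -> Num.conj (circle (t * x)) * circle (t * x) = 1.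
    move=> xm; apply: circle_unimodular; rewrite normrM (ger0_norm t0').
    by apply: le_trans tm; rewrite ler_wpM2l.
  pose u := lincomb (fun i => circle (t * a i)) p1.
  pose v := lincomb (fun i => circle (t * b i)) p2.
  pose w := lincomb (fun i => circle (t * c i)) p3.
  have ca i := circ _ (am i); have cb i := circ _ (bm i); have cc i := circ _ (cm i).
  have uu : unitary e u by apply: unitary_lincomb.
  have uv : unitary e v by apply: unitary_lincomb.
  have uw : unitary e w by apply: unitary_lincomb.
  have [rq1 ru] := rq rp1; have [rq2 rv] := rq rp2; have [rq3 rw] := rq rp3.
  have [h1 h2] := tri F e p1 p2 p3 _ _ _ rp1 rp2 rp3 erefl erefl erefl.
  have [h3 h4] := tri A E _ _ _ _ _ _ rq1 rq2 rq3 erefl erefl erefl.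
  rewrite -!ru // -!rv // -!rw // -/Ya -/Yb -/Yc -/u -/v -/w in h1 h2 h3 h4.
  rewrite X0 subrr scaler0 subr0 in h2.
  have g1 : nrm (u ** v - w) <= 7 * s ^+ 2.
    have -> : u ** v - w = (u - e) ** (v - e) + ((u - e) + (v - e) - (w - e)).
      by rewrite cmulBl !cmulBr (he u).2 (he v).1 (he e).1; nc_ring.
    by have := cnrmD ((u - e) ** (v - e)) (u - e + (v - e) - (w - e)); lra.
  have g2 : nrm (r u ** r v - r w) <= 7 * s ^+ 2.
    have us := unitary_star uw; have uuv := unitaryM he uu uv.
    have rwn : nrm (r w) <= 1.
      have := nrm_starM (r w); rewrite -rV // -rM // uw.1 r1.
      by have := nrm_projection pE; have := nrm_ge0 (r w); nra.
    have wn := nrm_unitary he us.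
    (* Multiplicativity moves the comparison to the identity, where [r_contraction] gives a
       bound. *)
    have -> : r u ** r v - r w = (r (u ** v ** star w) - E) ** r w.
      rewrite cmulBl -r1 -!rM //; [|exact: unitary1|exact: unitaryM].
      by rewrite -cmulA uw.1 (he _).2 (he w).1.
    apply: le_trans (nrmM_le (r_contraction (unitaryM he uuv us)) rwn) _.
    have -> : u ** v ** star w - e = (u ** v - w) ** star w by rewrite cmulBl uw.2.
    by rewrite mulr1 -[X in _ <= X]mulr1; exact: nrmM_le.
  have g3 : nrm (tau *: (Ya + Yb - Yc)) <= 14 * s ^+ 2.
    set Z := tau *: _ in h4 *.
    have Er : (r u - E) ** (r v - E) = r u ** r v - r u - r v + E.
      have [a1 a2] : E ** r v = r v /\ r u ** E = r u.
        by rewrite -r1 -!rM ?(he v).1 ?(he u).2 //; exact: unitary1.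
      by rewrite cmulBl !cmulBr a1 a2 pE.2; nc_ring.
    have -> : Z = (r u ** r v - r w) - (r u - E) ** (r v - E)
        - (r u - E + (r v - E) - (r w - E) - Z) by rewrite Er; nc_ring.
    set z := _ - Z in h4 *.
    have := cnrmB (r u ** r v - r w - (r u - E) ** (r v - E)) z.
    by have := cnrmB (r u ** r v - r w) ((r u - E) ** (r v - E)); lra.
  move: g3; rewrite nrm_imaginary // /s exprMn expr2 -mulrA mulrCA ler_pM2l //.
apply/eqP; rewrite -subr_eq0; apply/eqP; apply: nrm_small => eta eta0.
have m0 : 0 < m by apply: lt_le_trans m1.
pose t := Num.min m^-1 (eta / (14 * m ^+ 2)).
have M0 : 0 < 14 * m ^+ 2 by rewrite mulr_gt0 // exprn_gt0.
have t0 : 0 < t by rewrite lt_min invr_gt0 m0 divr_gt0.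
have t1 : t * m <= 1 by rewrite -ler_pdivlMr // div1r ge_min lexx.
apply: le_trans (bound _ t0 t1) _.
by rewrite mulrCA -ler_pdivlMr // ge_min lexx orbT.
Qed.

(** A relation, since an element has many resolutions; that [y] depends on [h] alone is a
    consequence of additivity, applied to [h + 0 = h]. *)
Definition real_image h y := exists k (p : 'I_k -> F) (a : 'I_k -> R),
  [/\ resolution e p, h = rlincomb a p & y = rlincomb a (fun i => q (p i))].

Lemma real_imageD h1 h2 y1 y2 y : real_image h1 y1 -> real_image h2 y2 ->
  real_image (h1 + h2) y -> y1 + y2 = y.
Proof.
move=> [k1 [p1 [a [rp1 -> ->]]]] [k2 [p2 [b [rp2 -> ->]]]] [k3 [p3 [c [rp3 X ->]]]].
exact: q_additive X.
Qed.

Lemma real_imageZ t h y : real_image h y -> real_image (t%:C *: h) (t%:C *: y).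
Proof.
move=> [k [p [a [rp -> ->]]]]; exists k, p, (fun i => t * a i).
by split => //; rewrite rlincombZ.
Qed.

Lemma real_image_uniq h y y' : real_image h y -> real_image h y' -> y = y'.
Proof.
move=> hy hy'; have := real_imageZ 0 hy; rewrite !scale0r => h0.
by have := real_imageD hy h0; rewrite !addr0; apply.
Qed.

Lemma real_decomposition h : star h = h -> exists k (p : 'I_k -> F) (a : 'I_k -> R),
  [/\ resolution e p, h = rlincomb a p & forall i, p i != 0].
Proof.
move=> sh; have [|k [p [l [rp hE pn0]]]] := hspec (a := h); first by rewrite sh.
exists k, p, (fun i => complex.Re (l i)); split=> //.
rewrite hE; apply: eq_lincomb => i.
have /eqP : (l i - Num.conj (l i)) *: p i = 0.
  rewrite scalerBl -(resolution_mulr rp l) -(resolution_mulr rp (fun i => Num.conj (l i))).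
  by rewrite -(lincomb_star rp) -hE sh subrr.
rewrite scaler_eq0 (negbTE (pn0 i)) orbF subr_eq0 eq_sym => /eqP lR.
by rewrite RRe_real //; apply/CrealP.
Qed.

Lemma real_image_exists h : star h = h -> exists y, real_image h y.
Proof.
move=> /real_decomposition[k [p [a [rp hE _]]]].
by exists (rlincomb a (fun i => q (p i))), k, p, a.
Qed.

(** The value [0] is a default outside the self-adjoint elements. *)
Definition selfadjoint_map h : A :=
  if pselect (exists y, real_image h y) is left H then projT1 (cid H) else 0.

Local Notation T := selfadjoint_map.

Lemma selfadjoint_mapP h : star h = h -> real_image h (T h).
Proof.
by move=> /real_image_exists H; rewrite /T; case: pselect => // H'; case: cid.
Qed.

Lemma selfadjoint_mapE h y : real_image h y -> T h = y.
Proof.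
move=> hy; apply: (real_image_uniq _ hy); apply: selfadjoint_mapP.
case: hy => k [p [a [rp -> _]]]; rewrite (lincomb_star rp).
by apply: eq_lincomb => i; rewrite conjCR.
Qed.

Lemma selfadjoint_mapD h k : star h = h -> star k = k -> T (h + k) = T h + T k.
Proof.
move=> sh sk; apply/esym; apply: (@real_imageD h k); try exact: selfadjoint_mapP.
by apply: selfadjoint_mapP; rewrite starD sh sk.
Qed.

Lemma selfadjoint_mapZ t h : star h = h -> T (t%:C *: h) = t%:C *: T h.
Proof. by move=> sh; apply: selfadjoint_mapE; apply: real_imageZ; exact: selfadjoint_mapP. Qed.

Lemma selfadjoint_mapN h : star h = h -> T (- h) = - T h.
Proof.
by move=> sh; have := selfadjoint_mapZ (-1) sh; rewrite rmorphN1 !scaleN1r.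
Qed.

Lemma selfadjoint_map_star h : star h = h -> star (T h) = T h.
Proof.
move=> /selfadjoint_mapP[k [p [a [rp _ ->]]]].
by rewrite (lincomb_star (rq rp).1); apply: eq_lincomb => i; rewrite conjCR.
Qed.

Local Notation im := ('i%C : R[i]).

Definition hre (x : F) : F := halve (x + star x).
(** This is [(x - star x) / (2 i)]. *)
Definition him (x : F) : F := halve (im *: (star x - x)).

Lemma imim (B : cstarAlgType R) (x : B) : im *: (im *: x) = - x.
Proof. by rewrite scalerA -expr2 sqr_i scaleN1r. Qed.

Lemma conj_im : Num.conj im = - im.
Proof. by rewrite conjCc; simpc. Qed.

Lemma halveZ (B : cstarAlgType R) l (x : B) : halve (l *: x) = l *: halve x.
Proof. by rewrite /halve !scalerA mulrC. Qed.

Lemma star_halve (B : cstarAlgType R) (x : B) : star (halve x) = halve (star x).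
Proof. by rewrite /halve starZr. Qed.

Lemma hre_him x : x = hre x + im *: him x.
Proof.
rewrite /hre /him halveZ imim -halveN -halveD -{1}[x]halve_double -halveD; congr halve.
by nc_ring.
Qed.

Lemma star_hre x : star (hre x) = hre x.
Proof. by rewrite /hre star_halve starD starK addrC. Qed.

Lemma star_him x : star (him x) = him x.
Proof.
rewrite /him star_halve starZ starB starK conj_im scaleNr -scalerN; congr (halve (_ *: _)).
by nc_ring.
Qed.

Definition linear_ext x : A := T (hre x) + im *: T (him x).

Local Notation psi := linear_ext.

Lemma linear_extD x y : psi (x + y) = psi x + psi y.
Proof.
have hreD : hre (x + y) = hre x + hre y.
  by rewrite /hre -halveD starD; congr halve; nc_ring.
have himD : him (x + y) = him x + him y.
  by rewrite /him -halveD -scalerDr starD; congr (halve (_ *: _)); nc_ring.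
rewrite /psi hreD himD !selfadjoint_mapD ?star_hre ?star_him // scalerDr; nc_ring.
Qed.

Lemma linear_ext_real t x : psi (t%:C *: x) = t%:C *: psi x.
Proof.
have hreZ : hre (t%:C *: x) = t%:C *: hre x.
  by rewrite /hre -halveZ starZr scalerDr.
have himZ : him (t%:C *: x) = t%:C *: him x.
  by rewrite /him -halveZ starZr -scalerBr !scalerA mulrC.
rewrite /psi hreZ himZ (selfadjoint_mapZ _ (star_hre x)) (selfadjoint_mapZ _ (star_him x)).
by rewrite scalerDr !scalerA mulrC.
Qed.

Lemma linear_ext_im x : psi (im *: x) = im *: psi x.
Proof.
have hreZ : hre (im *: x) = - him x.
  rewrite /hre /him -halveN starZ conj_im scaleNr -scalerBr -scalerN.
  by congr (halve (_ *: _)); nc_ring.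
have himZ : him (im *: x) = hre x.
  by rewrite /him starZ conj_im scaleNr -opprD -scalerDr scalerN imim opprK addrC.
rewrite /psi hreZ himZ selfadjoint_mapN ?star_him // scalerDr imim addrC.
by [].
Qed.

Lemma linear_extZ l x : psi (l *: x) = l *: psi x.
Proof.
rewrite (complexE l) !scalerDl linear_extD linear_ext_real -!scalerA.
by rewrite linear_ext_im linear_ext_real.
Qed.

Lemma linear_ext_star x : psi (star x) = star (psi x).
Proof.
have hreS : hre (star x) = hre x by rewrite /hre starK addrC.
have himS : him (star x) = - him x.
  rewrite /him starK -halveN -scalerN; congr (halve (_ *: _)); nc_ring.
rewrite /psi hreS himS selfadjoint_mapN ?star_him // starD starZ conj_im.
by rewrite !selfadjoint_map_star ?star_hre ?star_him // scalerN scaleNr.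
Qed.

Lemma linear_ext_rlincomb k (p : 'I_k -> F) a : resolution e p ->
  psi (rlincomb a p) = rlincomb a (fun i => q (p i)).
Proof.
move=> rp; set h := rlincomb a p.
have sh : star h = h.
  by rewrite (lincomb_star rp); apply: eq_lincomb => i; rewrite conjCR.
rewrite /psi /hre /him sh halveD halve_double subrr scaler0.
have -> : halve (0 : F) = 0%:C *: h by rewrite /halve scaler0 scale0r.
rewrite selfadjoint_mapZ // scale0r scaler0 addr0.
by apply: selfadjoint_mapE; exists k, p, a.
Qed.

(** Real and imaginary parts of the eigenvalues give two real combinations of the same resolution,
    on which [linear_ext] is known. *)
Lemma linear_ext_unitary u : unitary e u -> psi u = r u.
Proof.
move=> uu; have [|k [p [l [rp uE pn0]]]] := hspec (a := u); first by rewrite uu.1 uu.2.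
have [_ rl] := rq rp; rewrite uE in uu *; have l1 i := unitary_coef rp (pn0 i) uu.
have split (B : cstarAlgType R) (x : 'I_k -> B) : lincomb l x =
    rlincomb (fun i => complex.Re (l i)) x + im *: rlincomb (fun i => complex.Im (l i)) x.
  by rewrite /rlincomb lincombZ lincombD; apply: eq_lincomb => i; exact: complexE.
by rewrite rl // !split linear_extD linear_extZ !linear_ext_rlincomb.
Qed.

Lemma selfadjoint_unitaries m h : star h = h -> nrm h <= m -> 0 < m ->
  exists2 u, unitary e u & h = m%:C *: halve (u + star u).
Proof.
move=> /real_decomposition[k [p [a [rp -> pn0]]]] hm m0.
have am i : `|a i / m| <= 1.
  rewrite normrM normfV (gtr0_norm m0) ler_pdivrMr // mul1r.
  apply: le_trans hm; have := coef_le_nrm (fun i => (a i)%:C) rp (pn0 i).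
  by rewrite normcR.
pose c i := im * Num.conj (circle (a i / m)).
have c1 i : Num.conj (c i) * c i = 1.
  rewrite rmorphM /= conjCK mulrACA (mulrC (circle _)) circle_unimodular // mulr1.
  by rewrite conjCc; simpc.
exists (lincomb c p); first exact: unitary_lincomb.
rewrite (lincomb_star rp) lincombD /halve /rlincomb !lincombZ; apply: eq_lincomb => i.
rewrite /c rmorphM /= conjCK !conjCc /circle; simpc.
by congr (_ +i* _); field; rewrite gt_eqF.
Qed.

(** Every element is a combination of two self-adjoint ones, each a multiple of the sum of a unitary
    and its adjoint. This reduces multiplicativity of [linear_ext] to that of [r]. *)
Lemma unitary_span (P : F -> Prop) : (forall u, unitary e u -> P u) ->
  (forall x y, P x -> P y -> P (x + y)) -> (forall l x, P x -> P (l *: x)) ->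
  forall x, P x.
Proof.
move=> Pu PD PZ.
have Ps h : star h = h -> P h.
  move=> sh; have h0 := nrm_ge0 h.
  have h1 : nrm h <= nrm h + 1 by lra.
  have h2 : 0 < nrm h + 1 by lra.
  have [u uu ->] := selfadjoint_unitaries sh h1 h2.
  by apply: (PZ); apply: (PZ); apply: (PD); apply: (Pu) => //; exact: unitary_star.
move=> x; rewrite (hre_him x); apply: (PD); first by apply: Ps; exact: star_hre.
by apply: PZ; apply: Ps; exact: star_him.
Qed.

Lemma linear_extM x y : psi (x ** y) = psi x ** psi y.
Proof.
move: x y; apply: unitary_span => [u uu|x x' hx hx' y|l x hx y].
- apply: unitary_span => [w uw|y y' hy hy'|l y hy].
  + by have uuw := unitaryM he uu uw; rewrite !linear_ext_unitary // rM.
  + by rewrite cstar_mulDr !linear_extD hy hy' [RHS]cstar_mulDr.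
  + by rewrite cstar_scaleAr !linear_extZ hy [RHS]cstar_scaleAr.
- by rewrite cstar_mulDl !linear_extD hx hx' [RHS]cstar_mulDl.
- by rewrite cstar_scaleAl !linear_extZ hx [RHS]cstar_scaleAl.
Qed.

Lemma linear_ext_star_homomorphism : star_homomorphism psi.
Proof.
split; [|exact: linear_extM|exact: linear_ext_star].
by move=> l x y; rewrite linear_extD linear_extZ.
Qed.

Section Closeness.
Variables (phi : F -> A) (delta kappa : R).
Hypothesis hphi : delta_star_homomorphism delta phi.
Hypothesis rphi : forall u, unitary e u -> nrm (r u - phi u) <= kappa.

Lemma half_le1 :
  `|(2^-1 : R)%:C : R[i]| <= 1.
Proof. rewrite normcR -(rmorph1 (real_complex R)) lecR ger0_norm ?invr_ge0 //.
by rewrite invf_le1 // ler1n. Qed.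

Lemma near_selfadjoint h : star h = h -> nrm h <= 1 ->
  nrm (psi h - phi h) <= kappa + 3 * delta.
Proof.
move=> sh h1; have [u uu hE] := selfadjoint_unitaries sh h1 ltr01.
rewrite scale1r in hE; have us := unitary_star uu.
have un := nrm_unitary he uu; have usn := nrm_unitary he us.
have hu : nrm (halve u) <= 1 by rewrite nrm_halve; lra.
have hus : nrm (halve (star u)) <= 1 by rewrite nrm_halve; lra.
have k1 := approxD hphi hu hus.
have k2 := approxZ hphi un half_le1; have k3 := approxZ hphi usn half_le1.
have psiE : psi h = halve (r u) + halve (r (star u)).
  by rewrite hE /halve linear_extZ linear_extD !linear_ext_unitary // scalerDr.
have -> : psi h - phi h = halve (r u - phi u) + halve (r (star u) - phi (star u))
    - (phi (halve u + halve (star u)) - phi (halve u) - phi (halve (star u)))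
    - (phi (halve u) - halve (phi u)) - (phi (halve (star u)) - halve (phi (star u))).
  by rewrite psiE hE !halveD !halveN; nc_ring.
set x1 := halve (r u - _); set x2 := halve (r (star u) - _).
rewrite -/(halve _) in k2; rewrite -/(halve _) in k3.
set x3 := phi _ - _ - _ in k1 *; set x4 := phi (halve u) - _ in k2 *.
set x5 := phi (halve (star u)) - _ in k3 *.
have j1 : nrm x1 <= kappa / 2 by rewrite nrm_halve; have := rphi uu; lra.
have j2 : nrm x2 <= kappa / 2 by rewrite nrm_halve; have := rphi us; lra.
have := cnrmB (x1 + x2 - x3 - x4) x5; have := cnrmB (x1 + x2 - x3) x4.
by have := cnrmB (x1 + x2) x3; have := cnrmD x1 x2; lra.
Qed.

Lemma near_unit_ball x : nrm x <= 1 -> nrm (psi x - phi x) <= 2 * kappa + 8 * delta.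
Proof.
move=> x1; have sx : nrm (star x) <= 1 by rewrite nrm_star.
have hn : nrm (hre x) <= 1.
  by rewrite nrm_halve; have := cnrmD x (star x); lra.
have im1 (B : cstarAlgType R) (y : B) : nrm (im *: y) = nrm y.
  by rewrite nrm_imaginary // mul1r.
have kn : nrm (him x) <= 1.
  by rewrite nrm_halve im1; have := cnrmB (star x) x; lra.
have ikn : nrm (im *: him x) <= 1 by rewrite im1.
have imle : `|im| <= 1 by rewrite normc_def /= expr0n expr1n add0r sqrtr1.
have k1 := approxD hphi hn ikn; have k2 := approxZ hphi kn imle.
have j1 := near_selfadjoint (star_hre x) hn.
have j2 := near_selfadjoint (star_him x) kn.
have -> : psi x - phi x = (psi (hre x) - phi (hre x))
    + im *: (psi (him x) - phi (him x))
    - (phi (hre x + im *: him x) - phi (hre x) - phi (im *: him x))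
    - (phi (im *: him x) - im *: phi (him x)).
  have psiE : psi x = psi (hre x) + im *: psi (him x).
    by rewrite {1}(hre_him x) linear_extD (linear_extZ _ (him x)).
  by rewrite -(hre_him x) psiE scalerBr; nc_ring.
set y1 := psi (hre x) - _ in j1 *; set y2 := psi (him x) - _ in j2 *.
set y3 := phi _ - _ - _ in k1 *; set y4 := phi _ - _ in k2 *.
have j3 : nrm (im *: y2) <= kappa + 3 * delta by rewrite im1.
have := cnrmB (y1 + im *: y2 - y3) y4; have := cnrmB (y1 + im *: y2) y3.
by have := cnrmD y1 (im *: y2); lra.
Qed.

End Closeness.
End LinearExtension.

(** * The unitary group *)

Section UnitaryGroup.
Context {R : realType} {F : cstarAlgType R} {e : F}.
Variable he : unit_element e.

(** The argument makes the proof [he] part of the type, so that the group structure, which is built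
    from it, can be inferred. *)
Definition unitary_group of unit_element e : Type := {u : F | `[< unitary e u >]}.

Local Notation G := (unitary_group he).

HB.instance Definition _ := Choice.on G.

Definition unitary_sub u (uu : unitary e u) : G := exist _ u (asboolT uu).

Definition unitary_one : G := unitary_sub (unitary1 he).

Definition unitary_inv (u : G) : G := unitary_sub (unitary_star (asboolW (valP u))).

Definition unitary_mul (u w : G) : G :=
  unitary_sub (unitaryM he (asboolW (valP u)) (asboolW (valP w))).

Lemma unitary_mulA : associative unitary_mul.
Proof. by move=> u w z; apply: val_inj; rewrite /= cmulA. Qed.

Lemma unitary_mul1 : left_id unitary_one unitary_mul.
Proof. by move=> u; apply: val_inj; exact: (he _).1. Qed.

Lemma unitary_mulr1 : right_id unitary_one unitary_mul.
Proof. by move=> u; apply: val_inj; exact: (he _).2. Qed.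

Lemma unitary_mulV : left_inverse unitary_one unitary_inv unitary_mul.
Proof. by move=> u; apply: val_inj; have [] := asboolW (valP u). Qed.

Lemma unitary_mulrV : right_inverse unitary_one unitary_inv unitary_mul.
Proof. by move=> u; apply: val_inj; have [] := asboolW (valP u). Qed.

HB.instance Definition _ := isGroup.Build G unitary_mulA unitary_mul1 unitary_mulr1
  unitary_mulV unitary_mulrV.

Definition unitary_dist (u w : G) : R := nrm (val u - val w).

Lemma unitary_val (u : G) : unitary e (val u). Proof. exact: asboolW (valP u). Qed.

Lemma unitary_dist_invariant : bi_invariant unitary_dist.
Proof.
have unit1 u x : unitary e u -> nrm (u ** x) = nrm x.
  move=> uu; have un := nrm_unitary he uu; have us := nrm_unitary he (unitary_star uu).
  apply/le_anti/andP; split; first by have := nrmM_le un (lexx (nrm x)); rewrite mul1r.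
  rewrite -{1}[x](he x).1 -uu.1 -cmulA.
  by have := nrmM_le us (lexx (nrm (u ** x))); rewrite mul1r.
have unit2 u x : unitary e u -> nrm (x ** u) = nrm x.
  by move=> uu; rewrite -nrm_star starM unit1 ?nrm_star //; exact: unitary_star.
move=> x y z; have uz := unitary_val z; rewrite /unitary_dist /=.
by rewrite -cmulBl -cmulBr unit1 // unit2.
Qed.

Lemma unitary_dist_precompact (n : nat) (v : F -> 'rV[R[i]]_n) :
  linear v -> bijective v -> precompact_dist unitary_dist.
Proof.
move=> vlin [v' vK v'K] r r0.
have v'lin : linear v' by move=> l x y; apply: (can_inj vK); rewrite v'K vlin !v'K.
have [||||s hs] := @finite_net R F n v' v'lin _ G val r.
- exact: can_inj v'K.
- by exists v.
- exact: r0.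
- by move=> u; exact: (nrm_unitary he (unitary_val u)).
by exists s.
Qed.

End UnitaryGroup.

(** * From almost homomorphisms to approximate representations *)

Section Smoothing.
Context {R : realType} {F A : cstarAlgType R} {e : F}.
Variables (he : unit_element e) (phi : F -> A) (delta : R).
Hypotheses (d0 : 0 < delta) (d1 : delta <= 1 / 100 / 100 / 100).
Hypothesis hphi : delta_star_homomorphism delta phi.
Hypothesis Gpre : precompact_dist (unitary_dist (he := he)).

Local Notation G := (unitary_group he).
Local Notation d := (@unitary_dist R F e he).

(** The self-adjoint part of [phi e] has idempotency defect at most [4 delta], whence a projection
    within [40 delta] of it. *)
Lemma unit_image_near_projection :
  exists2 E : A, projection E & nrm (E - phi e) <= 41 * delta.
Proof.
have e1 := nrm_unitary he (unitary1 he).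
have p1 : nrm (phi e) <= 2 by have := approx_nrm hphi e1; have := d1; lra.
have ps := approx_star hphi e1; rewrite star_unit // in ps.
have pp := approxM hphi e1 e1; rewrite (he e).1 in pp.
pose a := halve (phi e + star (phi e)).
have sa : star a = a by rewrite star_halve starD starK addrC.
have a1 : nrm a <= 2.
  by rewrite nrm_halve; have := cnrmD (phi e) (star (phi e)); rewrite nrm_star; lra.
have ap : nrm (a - phi e) <= delta / 2.
  have -> : a - phi e = halve (star (phi e) - phi e).
    by rewrite /a -{3}[phi e]halve_double !halveD halveN; nc_ring.
  by rewrite nrm_halve cnrmC; lra.
have aa : nrm (a ** a - a) <= 4 * delta.
  have -> : a ** a - a = (a ** a - phi e ** phi e) - (phi e - phi e ** phi e) - (a - phi e).
    by nc_ring.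
  have := cnrmB (a ** a - phi e ** phi e - (phi e - phi e ** phi e)) (a - phi e).
  have := cnrmB (a ** a - phi e ** phi e) (phi e - phi e ** phi e).
  have := nrmM_sub a a (phi e) (phi e).
  have := ler_pM (nrm_ge0 _) (nrm_ge0 _) ap a1.
  have := ler_pM (nrm_ge0 _) (nrm_ge0 _) p1 ap.
  by have := d0; lra.
have [||E pE Ea] := @near_projection R A a (4 * delta) sa _ _ aa.
- by rewrite mulr_gt0.
- by have := d1; lra.
exists E => //.
by have := cnrm_sub a E (phi e); have := d0; lra.
Qed.

(** [phi] is nearly continuous at scale [delta]: if [nrm z <= delta] then [phi z] is near
    [delta *: phi (z / delta)], whose norm is at most [2 * delta]. *)
Lemma smoothed : exists2 f : G -> A, exists2 L, 0 <= L & dlipschitz d L f &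
  forall g, nrm (f g - phi (val g)) <= 4 * delta.
Proof.
have vn (g : G) : nrm (val g) <= 1 := nrm_unitary he (unitary_val g).
have h1 (x y : G) : d x y = d y x by exact: cnrmC.
have h2 (x y z : G) : d x z <= d x y + d y z by exact: cnrm_sub.
have h3 (x : G) : nrm (phi (val x)) <= 1 + delta by exact: approx_nrm.
have d2 : 0 < delta / 2 by rewrite divr_gt0.
have := @lipschitz_approximation R G A d h1 h2 Gpre (fun g => phi (val g)) _ (4 * delta) _ d2 h3.
apply => x y; rewrite mulrC divfK ?pnatr_eq0 // /unitary_dist => xy.
set z := val x - val y in xy.
have z1 : nrm z <= 1 by have := d1; lra.
have k1 := approxD hphi (vn y) z1; rewrite subrKC in k1.
have w1 : nrm (delta^-1%:C *: z) <= 1.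
  by rewrite nrmZr ger0_norm ?invr_ge0 ?ler_pdivrMl ?mulr1 // ltW.
have l1 : `|delta%:C : R[i]| <= 1.
  rewrite normcR -(rmorph1 (real_complex R)) lecR ger0_norm; last exact: ltW.
  by have := d1; lra.
have k2 := approxZ hphi w1 l1; have k3 := approx_nrm hphi w1.
rewrite scalerC2 divff ?gt_eqF // scale1r in k2.
have k4 : nrm (delta%:C *: phi (delta^-1%:C *: z)) <= 2 * delta.
  rewrite nrmZr gtr0_norm // mulrC ler_pM2r //.
  by have := d1; lra.
have := cnrm_subl (phi z) (delta%:C *: phi (delta^-1%:C *: z)).
have := cnrm_subl (phi (val x) - phi (val y)) (phi z).
rewrite addrAC in k1.
have -> : phi (val x) - phi (val y) - phi z = phi (val x) - phi z - phi (val y) by nc_ring.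
by rewrite addrAC in k1 *; lra.
Qed.

End Smoothing.

Section Stability.
Context {R : realType} {F A : cstarAlgType R}.

(** The smoothed map is symmetrized and compressed to [E ** h g ** E], which stays near [phi]
    because [phi e] acts nearly as a unit on the values of [phi]. The defect [1600 delta] covers
    [300 + 1 + 1200]. *)
Lemma approx_rep_near_unitaries {e : F} (he : unit_element e) (phi : F -> A) (delta : R) :
  0 < delta -> delta <= 1 / 100 / 100 / 100 -> delta_star_homomorphism delta phi ->
  precompact_dist (unitary_dist (he := he)) ->
  exists2 E : A, projection E & exists2 f : unitary_group he -> A,
    approx_rep (unitary_dist (he := he)) E (16 * (100 * delta)) f &
    forall g, nrm (f g - phi (val g)) <= 3 * (100 * delta).
Proof.
move=> d0 d1 hphi Gpre.
have [E pE hE] := unit_image_near_projection he d0 d1 hphi.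
have [f0 [L L0 f0L] f0phi] := smoothed d0 d1 hphi Gpre.
have E1 := nrm_projection pE; have [sE EE] := pE.
have vn (g : unitary_group he) : nrm (val g) <= 1 := nrm_unitary he (unitary_val g).
have e1 : nrm e <= 1 := nrm_unitary he (unitary1 he).
pose h (g : unitary_group he) : A := halve (f0 g + star (f0 g^-1%g)).
have hphi' g : nrm (h g - phi (val g)) <= 5 * delta.
  have sg : nrm (star (val g)) <= 1 by rewrite nrm_star; exact: vn.
  have k1 := f0phi g; have k2 := f0phi g^-1%g; have k3 := approx_star hphi sg.
  rewrite starK in k3; rewrite -[val g^-1%g]/(star (val g)) in k2.
  rewrite -nrm_star starB in k2.
  set x := phi (val g) in k1 k3 *; set y := star (phi (star (val g))) in k2 k3.
  have -> : h g - x = halve ((f0 g - x) + (star (f0 g^-1%g) - y) - (x - y)).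
    rewrite /h -{1}[x]halve_double -halveD -halveB; congr halve; nc_ring.
  rewrite nrm_halve.
  have := cnrmB (f0 g - x + (star (f0 g^-1%g) - y)) (x - y).
  by have := cnrmD (f0 g - x) (star (f0 g^-1%g) - y); lra.
have pn (x : F) : nrm x <= 1 -> nrm (phi x) <= 2.
  by move=> x1; have := approx_nrm hphi x1; lra.
have hn g : nrm (h g) <= 2.
  by have := cnrm_subl (h g) (phi (val g)); have := hphi' g; have := approx_nrm hphi (vn g); lra.
pose f g := E ** h g ** E.
have fphi g : nrm (f g - phi (val g)) <= 3 * (100 * delta).
  set x := phi (val g); set y := phi e.
  have k1 := approxM hphi e1 (vn g); rewrite (he _).1 -/x -/y in k1.
  have k2 := approxM hphi (vn g) e1; rewrite (he _).2 -/x -/y in k2.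
  have y2 : nrm y <= 2 := pn _ e1.
  have j1 : nrm (E ** h g - y ** x) <= 92 * delta.
    apply: le_trans (nrmM_sub _ _ _ _) _.
    have := ler_pM (nrm_ge0 _) (nrm_ge0 _) hE (hn g).
    by have := ler_pM (nrm_ge0 _) (nrm_ge0 _) y2 (hphi' g); rewrite -/x -/y; lra.
  have x2 : nrm x <= 2 := pn _ (vn g).
  have j2 := nrmM_le y2 x2.
  have j3 : nrm (E ** h g ** E - y ** x ** y) <= 92 * delta + 4 * (41 * delta).
    apply: le_trans (nrmM_sub _ _ _ _) _.
    have := ler_pM (nrm_ge0 _) (nrm_ge0 _) j1 E1.
    by have := ler_pM (nrm_ge0 _) (nrm_ge0 _) j2 hE; rewrite -/y; lra.
  have j4 := nrmM_le k1 y2; rewrite cmulBl in j4.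
  have -> : f g - x = (E ** h g ** E - y ** x ** y) - (x ** y - y ** x ** y) - (x - x ** y).
    by rewrite /f; nc_ring.
  have := cnrmB (E ** h g ** E - y ** x ** y - (x ** y - y ** x ** y)) (x - x ** y).
  by have := cnrmB (E ** h g ** E - y ** x ** y) (x ** y - y ** x ** y); lra.
have fn g : nrm (f g) <= 2.
  by have := nrmM_le (nrmM_le E1 (hn g)) E1; rewrite mulr1 mul1r.
exists E => //; exists f => //; split.
- exists L => // x y.
  have -> : f x - f y = E ** (h x - h y) ** E by rewrite /f; nc_ring.
  have hL : nrm (h x - h y) <= L * unitary_dist x y.
    rewrite /h -halveB nrm_halve.
    have -> : f0 x + star (f0 x^-1%g) - (f0 y + star (f0 y^-1%g)) =
      (f0 x - f0 y) + star (f0 x^-1%g - f0 y^-1%g) by rewrite starB; nc_ring.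
    have := cnrmD (f0 x - f0 y) (star (f0 x^-1%g - f0 y^-1%g)); rewrite nrm_star.
    have := f0L x y; have := f0L x^-1%g y^-1%g.
    have -> : unitary_dist x^-1%g y^-1%g = unitary_dist x y.
      by rewrite /unitary_dist /= -starB nrm_star.
    by lra.
  by have := nrmM_le (nrmM_le E1 hL) E1; rewrite mulr1 mul1r.
- by move=> g; rewrite /f !cmulA EE -!cmulA EE.
- move=> g; rewrite /f !starM sE cmulA; congr (_ ** _ ** _).
  by rewrite /h star_halve starD starK invgK addrC.
- move=> x y; have k1 := approxM hphi (vn x) (vn y).
  have -> : f (x * y)%g - f x ** f y = (f (x * y)%g - phi (val x ** val y))
      + (phi (val x ** val y) - phi (val x) ** phi (val y))
      - (f x ** f y - phi (val x) ** phi (val y)) by nc_ring.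
  have k2 : nrm (f (x * y)%g - phi (val x ** val y)) <= 3 * (100 * delta) := fphi (x * y)%g.
  have := nrmM_sub (f x) (f y) (phi (val x)) (phi (val y)).
  have := ler_pM (nrm_ge0 _) (nrm_ge0 _) (fphi x) (fn y).
  have := ler_pM (nrm_ge0 _) (nrm_ge0 _) (pn _ (vn x)) (fphi y).
  set z1 := f (x * y)%g - _ in k2 *; set z2 := phi (val x ** val y) - _ in k1 *.
  set z3 := f x ** f y - _.
  by have := cnrmB (z1 + z2) z3; have := cnrmD z1 z2; lra.
- have k1 : nrm (f 1%g - phi e) <= 3 * (100 * delta) := fphi 1%g.
  by have := cnrm_sub (phi e) (f 1%g) E; rewrite (cnrmC (phi e)); lra.
Qed.

Theorem delta_star_homomorphism_stable (phi : F -> A) (delta : R) :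
  0 < delta -> delta <= 1 / 100 / 100 / 100 -> finite_dimensional F ->
  delta_star_homomorphism delta phi ->
  exists psi : F -> A, star_homomorphism psi /\
    forall x, nrm x <= 1 -> nrm (psi x - phi x) <= 2 * (67 * (100 * delta)) + 8 * delta.
Proof.
move=> d0 d1 [n [[v vlin vbij]]] hphi.
have [e _ he] := unit_exists vlin vbij.
have Gpre := unitary_dist_precompact he vlin vbij.
have [E pE [f fr fphi]] := approx_rep_near_unitaries d0 d1 hphi Gpre.
have [|| rho [rhoM rhoV rho1 rhof]] :=
  approx_rep_stability (unitary_dist_invariant (he := he)) Gpre pE _ _ fr.
- by rewrite !mulr_gt0.
- by lra.
(* [0] is a default value off the unitary group. *)
pose r u := if pselect (unitary e u) is left uu then rho (unitary_sub he uu) else 0.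
have rE u (uu : unitary e u) : r u = rho (unitary_sub he uu).
  by rewrite /r; case: pselect => // uu'; congr rho; apply: val_inj.
have rM u w : unitary e u -> unitary e w -> r (u ** w) = r u ** r w.
  move=> uu uw; rewrite (rE _ uu) (rE _ uw) (rE _ (unitaryM he uu uw)) -rhoM.
  by congr rho; apply: val_inj.
have rV u : unitary e u -> r (star u) = star (r u).
  move=> uu; rewrite (rE _ uu) (rE _ (unitary_star uu)) -rhoV.
  by congr rho; apply: val_inj.
have r1 : r e = E.
  by rewrite (rE _ (unitary1 he)) -rho1; congr rho; apply: val_inj.
have rphi u : unitary e u -> nrm (r u - phi u) <= 67 * (100 * delta).
  move=> uu; rewrite (rE _ uu); set g := unitary_sub he uu.
  have k1 : nrm (f g - phi u) <= 3 * (100 * delta) := fphi g.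
  by have := cnrm_sub (f g) (rho g) (phi u); have := rhof g; lra.
have dk : delta <= 67 * (100 * delta) by lra.
have k1 : 67 * (100 * delta) <= 1 / 100 by lra.
have hspec a : star a ** a = a ** star a -> _ := spectral he vlin vbij.
have rq k (p : 'I_k -> F) : resolution e p ->
    resolution E (fun i => qproj e E r (p i)) /\
    forall c, (forall i, Num.conj (c i) * c i = 1) ->
      r (lincomb c p) = lincomb c (fun i => qproj e E r (p i)).
  move=> rp; split; first exact: (qproj_resolution he pE hphi dk k1 rM rV r1 rphi rp).
  by move=> c; exact: (r_lincomb he pE hphi dk k1 rM rV r1 rphi rp).
exists (linear_ext e (qproj e E r)); split.
  exact: (linear_ext_star_homomorphism he pE rM rV r1 rq hspec).
exact: (near_unit_ball he pE rM rV r1 rq hspec hphi rphi).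
Qed.

End Stability.

Theorem theorem1 (R : realType) (eps : R) (eps_gt0 : 0 < eps) :
  exists delta : R, 0 < delta /\
    forall (F A : cstarAlgType R) (phi : F -> A),
      finite_dimensional F ->
      delta_star_homomorphism delta phi ->
      exists psi : F -> A,
        star_homomorphism psi /\
        forall x : F, `|x| <= 1 -> `|psi x - phi x| < eps%:C.
Proof.
(* The final error is [(2 * 6700 + 8) delta]. *)
pose delta : R := Num.min (1 / 100 / 100 / 100) (eps / 100 / 100 / 100).
have d0 : 0 < delta by rewrite lt_min; apply/andP; split; lra.
have d1 : delta <= 1 / 100 / 100 / 100 by rewrite ge_min lexx.
have d2 : delta <= eps / 100 / 100 / 100 by rewrite ge_min lexx orbT.
exists delta; split=> // F A phi fdF hphi.
have [psi [hpsi near]] := delta_star_homomorphism_stable d0 d1 fdF hphi.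
exists psi; split=> // x; rewrite nrm_le1 nrm_lt => x1.
by apply: le_lt_trans (near x x1) _; lra.
Qed.
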